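(* Let $1\le\alpha<\infty$ be fixed. There is a mapping $\mathcal{F}\colon\mathcal{P}(\omega)/\mathrm{fin}\to C[0,1]$, with each $\mathcal{F}(U)$ nonnegative, such that for every $U,V\in\mathcal{P}(\omega)/\mathrm{fin}$, $\mathbf{E}_{\mathcal{F}(U)}$ is an equivalence relation satisfying $$\mathbf{E}_{\mathrm{Id}^{\alpha}/(1-\log)^{1-\log(17/16)}}\le_B\mathbf{E}_{\mathcal{F}(U)}\le_B\mathbf{E}_{\mathrm{Id}^{\alpha}/(1-\log)},$$ and $$U\subset V\ \Rightarrow\ \mathbf{E}_{\mathcal{F}(V)}<_B\mathbf{E}_{\mathcal{F}(U)}.$$
   Context: For $f\colon[0,1]\to[0,\infty)$, $\mathbf{E}_f$ is the relation on $[0,1]^{\omega}$ given by $(x_n)\,\mathbf{E}_f\,(y_n)\iff\sum_{n<\omega}f(|y_n-x_n|)<\infty$. For $c>0$, $\mathrm{Id}^{\alpha}/(1-\log)^{c}$ is the function $x\mapsto x^{\alpha}/(1-\log x)^{c}$ for $0<x\le1$, with value $0$ at $0$; $\log$ is the natural logarithm. $\mathcal{P}(\omega)/\mathrm{fin}$ is the set of subsets of $\omega$ modulo finite differences; for classes of $U,V\subseteq\omega$, $U\subset V$ is the strict order: $U\setminus V$ is finite and $V\setminus U$ is infinite. $C[0,1]$ is the set of continuous real functions on $[0,1]$. For equivalence relations $E$ on a Polish space $X$ and $F$ on a Polish space $Y$, $E\le_B F$ means there is a Borel function $\vartheta\colon X\to Y$ with $x\,E\,x'\iff\vartheta(x)\,F\,\vartheta(x')$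 for all $x,x'\in X$; $E<_B F$ means $E\le_B F$ and $F\not\le_B E$. *)

(* Defs.v *)
From HB Require Import structures.
From mathcomp Require Import all_boot all_order all_algebra generic_quotient.
From mathcomp Require Import all_classical all_reals all_analysis.

Set Implicit Arguments.
Unset Strict Implicit.
Unset Printing Implicit Defensive.

Import Order.TTheory GRing.Theory Num.Theory.
Import numFieldNormedType.Exports.

Local Open Scope classical_set_scope.
Local Open Scope ring_scope.
Local Open Scope quotient_scope.

(* <<s open >> is the Borel sigma-algebra.  The definitions up to
   [borel_lt] make sense on all topological spaces; they are only used on the
   Polish space [hilbert_cube] below. *)
Definition borel_fun (X Y : topologicalType) (theta : X -> Y) : Prop :=
  forall B : set Y, <<s @open Y >> B -> <<s @open X >> (theta @^-1` B).

Definition borel_le (X Y : topologicalType)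
    (E : X -> X -> Prop) (F : Y -> Y -> Prop) : Prop :=
  exists2 theta : X -> Y, borel_fun theta &
    forall x x' : X, E x x' <-> F (theta x) (theta x').

Definition borel_lt (X Y : topologicalType)
    (E : X -> X -> Prop) (F : Y -> Y -> Prop) : Prop :=
  borel_le E F /\ ~ borel_le F E.

Definition unit_itv (R : realType) := set_type (`[0, 1]%classic : set R).

HB.instance Definition _ (R : realType) := Topological.on (unit_itv R).

(* [0,1]^omega with the product topology *)
Definition hilbert_cube (R : realType) := {ptws nat -> unit_itv R}.

HB.instance Definition _ (R : realType) := Topological.on (hilbert_cube R).

Lemma unit_dist_subproof (R : realType) (x y : unit_itv R) :
  `|\val y - \val x| \in (`[0, 1]%classic : set R).
Proof.
case: x y => [x /= /set_mem xI] [y /= /set_mem yI]; apply/mem_set.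
move: xI yI; rewrite /= !in_itv /= => /andP[x0 x1] /andP[y0 y1].
by rewrite normr_ge0 ler_distlC lerBlDr (le_trans x1) ?lerDr //=
  (le_trans y1) // lerDr.
Qed.

Definition unit_dist (R : realType) (x y : unit_itv R) : unit_itv R :=
  exist _ `|\val y - \val x| (unit_dist_subproof x y).

(* Meant for nonnegative f, for which the series always has a sum in
   [0, +oo]. *)
Definition Erel (R : realType) (f : unit_itv R -> R)
    (x y : hilbert_cube R) : Prop :=
  (\sum_(0 <= n <oo) (f (unit_dist (x n) (y n)))%:E < +oo)%E.

(* Id^alpha / (1 - log)^c.  The case distinction is needed: ln 0 = 0 here. *)
Definition id_pow_log (R : realType) (alpha c : R) (x : unit_itv R) : R :=
  if \val x == 0 then 0 else \val x `^ alpha / (1 - ln (\val x)) `^ c.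

Definition eq_mod_fin (U V : set nat) : bool :=
  `[< finite_set (U `\` V) /\ finite_set (V `\` U) >].

Lemma finite_setD_trans (U V W : set nat) :
  finite_set (U `\` V) -> finite_set (V `\` W) -> finite_set (U `\` W).
Proof.
move=> UV VW; have : finite_set ((U `\` V) `|` (V `\` W)) by rewrite finite_setU.
apply: sub_finite_set => n [Un nWn].
by have [Vn|nVn] := pselect (V n); [right|left].
Qed.

Lemma eq_mod_fin_refl : reflexive eq_mod_fin.
Proof. by move=> U; apply/asboolP; rewrite setDv. Qed.

Lemma eq_mod_fin_sym : symmetric eq_mod_fin.
Proof. by move=> U V; apply/asboolP/asboolP => -[]. Qed.

Lemma eq_mod_fin_trans : transitive eq_mod_fin.
Proof.
move=> V U W /asboolP[UV VU] /asboolP[VW WV]; apply/asboolP.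
by split; [exact: finite_setD_trans UV VW|exact: finite_setD_trans WV VU].
Qed.

Canonical eq_mod_fin_equiv :=
  EquivRel eq_mod_fin eq_mod_fin_refl eq_mod_fin_sym eq_mod_fin_trans.

(* P(omega)/fin *)
Definition Pomega_fin := {eq_quot eq_mod_fin_equiv}.

HB.instance Definition _ := Quotient.on Pomega_fin.

(* The choice of representatives is irrelevant: see [Pomega_fin_ltE]. *)
Definition Pomega_fin_lt (u v : Pomega_fin) : Prop :=
  finite_set (repr u `\` repr v) /\ infinite_set (repr v `\` repr u).

Lemma Pomega_fin_ltE (U V : set nat) :
  Pomega_fin_lt (\pi_Pomega_fin U) (\pi_Pomega_fin V) <->
  finite_set (U `\` V) /\ infinite_set (V `\` U).
Proof.
have rP (W : set nat) : finite_set (repr (\pi_Pomega_fin W) `\` W) /\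
    finite_set (W `\` repr (\pi_Pomega_fin W)).
  by have /eqmodP/asboolP := reprK (\pi_Pomega_fin W).
have [U1 U2] := rP U; have [V1 V2] := rP V.
split=> -[fUV iVU]; split.
- exact: finite_setD_trans U2 (finite_setD_trans fUV V1).
- by move=> fVU; apply: iVU;
    exact: finite_setD_trans V1 (finite_setD_trans fVU U2).
- exact: finite_setD_trans U1 (finite_setD_trans fUV V2).
- by move=> fVU; apply: iVU;
    exact: finite_setD_trans V2 (finite_setD_trans fVU U1).
Qed.

(* Main.v *)
Require Import Defs.
From HB Require Import structures.
From mathcomp Require Import all_boot all_order all_algebra.
From mathcomp Require Import all_classical all_reals all_analysis.
From mathcomp Require Import zify ring lra.
Import Order.TTheory GRing.Theory Num.Theory.
Import numFieldNormedType.Exports.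
Local Open Scope classical_set_scope.
Local Open Scope ring_scope.

Set Implicit Arguments.
Unset Strict Implicit.
Unset Printing Implicit Defensive.

(* For [W] a set of naturals let [f_W x = x^alpha exp(p S_W(t) - t)], where
   [t = ln (1 - ln x)], [p = ln (17/16)] and [S_W(t)] is the measure of the part of
   [[0, t]] covered by the intervals [[n, n+1]], [n \in W].  Then [f_set0] and
   [f_setT] are the upper and the lower bound of the theorem, and [F(U) = f_U]
   works: changing [W] by a finite set changes [f_W] by a bounded factor only.

   If [U `<=` V], the factor [f_V x / f_U x] increases as [x] tends to 0, and [E_{f_V}]
   reduces to [E_{f_U}] by sending each coordinate [x] to the triangle waves of
   slope 1 and wave length about [exp(-i)], for those [i] at which the integer part of
   the factor at [x = exp(-i)] jumps.

   If moreover [V `\` U] is infinite, [f_V / f_U] is unbounded, so some sequence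
   [M_t] has [sum f_U(1/M_t)] finite and [sum f_V(1/M_t)] infinite.  A Borel
   reduction of [E_{f_U}] to [E_{f_V}] is continuous on a comeager set, and as in
   Dougherty and Hjorth one finds coordinates, the [t]-th one ranging over the
   multiples of [1/M_t] in [[0, 1]], on which it is additive up to a summable
   error: the [t]-th coordinate moves only the [t]-th block of the image.  A step
   of length [1/M_t] moves the block by a summable amount, hence, by the convexity
   of [f_V], the path from 0 to 1 moves it by [O(a_t / f_V(1/M_t))] with
   [a_t] summable; this is incompatible with 0 and 1 being far apart in infinitely
   many coordinates. *)

(** * Baire category on the space of sequences *)

Section Splice.

Implicit Types (s w a : seq nat) (x y : nat -> nat) (P Q C : set (nat -> nat)).

(** The default value of [nth] makes the positions beyond [s] keep the entries of [y], so the range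
    of [splice s] is the cylinder of [s]. *)
Definition splice s y : nat -> nat := fun n => nth (y n) s n.

Lemma splice_nil y : splice [::] y = y.
Proof. by apply/funext => n; rewrite /splice nth_nil. Qed.

Lemma splice_ge s y n : (size s <= n)%N -> splice s y n = y n.
Proof. by move=> sn; rewrite /splice nth_default. Qed.

Lemma splice_splice a s y :
  splice a (splice s y) = splice (a ++ drop (size a) s) y.
Proof.
apply/funext => n; rewrite /splice nth_cat; case: ltnP => an.
  by apply: set_nth_default.
by rewrite (nth_default _ an) nth_drop subnKC.
Qed.

Lemma splice_cat s w y : splice s (splice (s ++ w) y) = splice (s ++ w) y.
Proof. by rewrite splice_splice drop_size_cat. Qed.

Lemma splice_swap a s w y : size a = size s ->
  splice a (splice (s ++ w) y) = splice (a ++ w) y.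
Proof. by move=> sz; rewrite splice_splice sz drop_size_cat. Qed.

Lemma splice_mkseq x n : splice (mkseq x n) x = x.
Proof.
apply/funext => m; rewrite /splice; case: (ltnP m n) => mn.
  by rewrite nth_mkseq.
by rewrite nth_default // size_mkseq.
Qed.

Lemma splice_mkseqK x n m y : (n <= m)%N ->
  splice (mkseq x n) (splice (mkseq x m) y) = splice (mkseq x m) y.
Proof.
move=> nm; have -> : mkseq x m = mkseq x n ++ mkseq (fun i => x (n + i)%N) (m - n).
  by rewrite /mkseq -{1}(subnKC nm) iotaD map_cat add0n -{2}[n]addn0 iotaDl -map_comp.
exact: splice_cat.
Qed.

Lemma mkseq_splice s x n : (size s <= n)%N ->
  exists w, mkseq (splice s x) n = s ++ w.
Proof.
move=> sn; exists (drop (size s) (mkseq (splice s x) n)).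
rewrite -{1}[mkseq _ _](cat_take_drop (size s)); congr (_ ++ _).
apply: (@eq_from_nth _ 0%N); first by rewrite size_takel ?size_mkseq.
rewrite size_takel ?size_mkseq // => i ilt; rewrite nth_take //.
by rewrite nth_mkseq ?(leq_trans ilt)// /splice; apply: set_nth_default.
Qed.

Lemma mkseq_spliceK s x : mkseq (splice s x) (size s) = s.
Proof.
have [//|w e] := @mkseq_splice s x (size s).
have /eqP := congr1 size e; rewrite size_cat size_mkseq -[eqbLHS]addn0 eqn_add2l eq_sym.
by move=> /nilP w0; rewrite e w0 cats0.
Qed.

(* [P] contains an open dense subset of the cylinder of [s]. *)
Definition odense_in s P := forall w, exists w', forall y,
  P (splice (s ++ w ++ w') y).

Lemma odense_inS s P : odense_in [::] P -> odense_in s P.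
Proof. by move=> dP w; have [w' /= Pw] := dP (s ++ w); exists w' => y; rewrite catA. Qed.

Lemma odense_inI s P Q : odense_in s P -> odense_in s Q -> odense_in s (P `&` Q).
Proof.
move=> dP dQ w; have [w1 Pw] := dP w; have [w2 Qw] := dQ (w ++ w1).
exists (w1 ++ w2) => y; split; last by have := Qw y; rewrite -!catA.
rewrite !catA -splice_cat -!catA; exact: Pw.
Qed.

(** Pad [w] to at least the length of [a]. Overwriting by [a] leaves the later letters alone, so the
    extension found for the overwritten word also serves for the padded one. *)
Lemma odense_splice a P : odense_in [::] P -> odense_in [::] [set x | P (splice a x)].
Proof.
move=> dP w; pose s := w ++ nseq (size a) 0%N.
have as_ : (size a <= size s)%N by rewrite /s size_cat size_nseq leq_addl.
have [w' /= Pw] := dP (a ++ drop (size a) s).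
exists (nseq (size a) 0%N ++ w') => y /=; rewrite splice_splice catA -/s.
rewrite drop_cat; case: ltnP => h; first by rewrite catA; exact: Pw.
have e : size a = size s by apply/eqP; rewrite eqn_leq as_.
by have := Pw y; rewrite e drop_size subnn drop0 cats0.
Qed.

(** The entry [x n] is read off [u n.+1], which is long enough. The conclusion, that [x] starts with
    [u i], is phrased so that its tail may come from any [y] with the same tail. *)
Lemma limit_prefix (u : nat -> seq nat) :
  (forall i, exists w, u i.+1 = u i ++ w) -> (forall i, i <= size (u i))%N ->
  exists x : nat -> nat, forall i y, (forall m, (size (u i) <= m)%N -> x m = y m) ->
     x = splice (u i) y.
Proof.
move=> uS us; exists (fun n => nth 0%N (u n.+1) n) => i y xy.
have pre j k : (j <= k)%N -> exists w, u k = u j ++ w.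
  move=> /subnK <-; elim: (k - j)%N => [|n [w IH]]; first by exists [::]; rewrite cats0.
  by have [w' ->] := uS (n + j)%N; rewrite IH; exists (w ++ w'); rewrite catA.
apply/funext => n; case: (ltnP n (size (u i))) => ni; last by rewrite splice_ge// xy.
rewrite /splice (set_nth_default 0%N _ ni).
have [w ew] := pre _ _ (leq_maxl i n.+1); have [w' ew'] := pre _ _ (leq_maxr i n.+1).
have := congr1 (fun s => nth 0%N s n) (etrans (esym ew) ew').
by rewrite !nth_cat ni us.
Qed.

Lemma baire s (P : nat -> set (nat -> nat)) : (forall i, odense_in s (P i)) ->
  exists y, forall i, P i (splice s y).
Proof.
move=> dP; have /choice[e eP] : forall p : nat * seq nat, exists w',
    forall y, P p.1 (splice (s ++ p.2 ++ w') y) by move=> p; exact: dP.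
(* The extension [e] may be empty; the additional letter 0 forces the words to grow. *)
pose u := fix u i := if i is j.+1 then u j ++ e (j, u j) ++ [:: 0%N] else [::].
have [|i|x xP] := @limit_prefix (fun i => s ++ u i).
- by move=> i; exists (e (i, u i) ++ [:: 0%N]); rewrite /= !catA.
- rewrite size_cat; apply: leq_trans (leq_addl _ _).
  by elim: i => //= i IH; rewrite !size_cat /=; lia.
have xE i : splice (s ++ u i) x = x by rewrite -(xP i x).
exists x => i; have := xE 0%N; rewrite /= cats0 => ->.
rewrite -(xE i.+1) /= !catA -splice_cat -!catA; exact: eP (i, u i) _.
Qed.

Definition comeager P := exists2 D : nat -> set (nat -> nat),
  (forall i, odense_in [::] (D i)) & \bigcap_i D i `<=` P.

Lemma odense_comeager P : odense_in [::] P -> comeager P.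
Proof. by move=> dP; exists (fun=> P) => // x /(_ 0%N I). Qed.

Lemma comeager_bigcap (T : countType) (P : T -> set (nat -> nat)) :
  (forall t, comeager (P t)) -> comeager (\bigcap_t P t).
Proof.
move=> cP; have /choice[D DP] : forall t, exists D : nat -> set (nat -> nat),
    (forall i, odense_in [::] (D i)) /\ \bigcap_i D i `<=` P t.
  by move=> t; have [D] := cP t; exists D.
exists (fun n => if unpickle n is Some (t, i) then D t i else setT).
  move=> n; case: unpickle => [[t i]|]; first exact: (DP t).1.
  by move=> w; exists [::].
move=> x Dx t _; apply: (DP t).2 => i _.
by have := Dx (pickle (t, i)) I; rewrite pickleK.
Qed.

Lemma comeagerI P Q : comeager P -> comeager Q -> comeager (P `&` Q).
Proof.
move=> cP cQ; have [|D dD Dsub] := @comeager_bigcap bool (fun b => if b then P else Q).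
  by case.
exists D => // x /Dsub h; split; [exact: (h true I)|exact: (h false I)].
Qed.

Definition splice_invariant P := forall s y, P y -> P (splice s y).

(** There are countably many words [s], so the preimages of all [D i] under all [splice s] can be
    intersected. Invariance later allows prefixes to be exchanged without leaving the set. *)
Lemma comeager_invariant P : comeager P -> exists2 D : nat -> set (nat -> nat),
  (forall i, odense_in [::] (D i)) &
  \bigcap_i D i `<=` P /\ splice_invariant (\bigcap_i D i).
Proof.
move=> [D dD DP].
exists (fun n => if unpickle n is Some (s, i) then [set x | D i (splice s x)] else setT).
  move=> n; case: unpickle => [[s i]|]; first exact: odense_splice.
  by move=> w; exists [::].
split=> [x Dx|a x Dx n _].
  by apply: DP => i _; have := Dx (pickle ([::] : seq nat, i)) I; rewrite pickleK /= splice_nil.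
case: unpickle => [[s i]|//]; rewrite /= splice_splice.
by have := Dx (pickle (s ++ drop (size s) a, i)) I; rewrite pickleK.
Qed.

(* On [C] the indicator of [A] is continuous. *)
Definition decided_in C A := forall x, C x -> exists n,
  (forall y, C (splice (mkseq x n) y) -> A (splice (mkseq x n) y)) \/
  (forall y, C (splice (mkseq x n) y) -> ~ A (splice (mkseq x n) y)).

(** An equivalent of the usual Baire property (equality with an open set up to a meager set). *)
Definition baire_prop (A : set (nat -> nat)) := exists2 C, comeager C & decided_in C A.

(** The points with a deciding neighbourhood contain a dense open set: either a cylinder has a point
    of [C] in [A], and then a smaller cylinder lies in [A] relative to [C], or the cylinder itself
    decides against [A]. *)
Lemma rel_open_baire_prop C A : comeager C ->
  (forall x, C x -> A x -> exists n, forall y,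
    C (splice (mkseq x n) y) -> A (splice (mkseq x n) y)) -> baire_prop A.
Proof.
move=> cC oA.
pose D := [set x | exists n,
  (forall y, C (splice (mkseq x n) y) -> A (splice (mkseq x n) y)) \/
  (forall y, C (splice (mkseq x n) y) -> ~ A (splice (mkseq x n) y))].
exists (C `&` D); last first.
  by move=> x [Cx [n [h|h]]]; exists n; [left|right] => y [+ _]; exact: h.
apply: comeagerI => //; apply: odense_comeager => s /=.
have [[y [Cy Ay]]|none] := pselect (exists y, C (splice s y) /\ A (splice s y)).
  have [n nP] := oA _ Cy Ay.
  have [//|w e] := @mkseq_splice s y (maxn n (size s)); first exact: leq_maxr.
  exists w => z; rewrite -e.
  exists (maxn n (size s)); left => t.
  set u := mkseq (splice s y) _.
  have -> : maxn n (size s) = size u by rewrite size_mkseq.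
  rewrite mkseq_spliceK.
  by rewrite -(@splice_mkseqK _ n) ?leq_maxl//; exact: nP.
exists [::] => y; exists (size s); right => z; rewrite cats0 mkseq_spliceK => Cz Az.
by apply: none; exists z.
Qed.

Lemma baire_propC A : baire_prop A -> baire_prop (~` A).
Proof.
move=> [C cC dA]; exists C => // x /dA[n [h|h]]; exists n; last by left.
by right => y /h Ay; apply.
Qed.

(** On the intersection of the [C i] the union is relatively open. *)
Lemma baire_prop_bigcup (A : nat -> set (nat -> nat)) :
  (forall i, baire_prop (A i)) -> baire_prop (\bigcup_i A i).
Proof.
move=> bA; have /choice[C CP] : forall i, exists C, comeager C /\ decided_in C (A i).
  by move=> i; have [C] := bA i; exists C.
apply: (@rel_open_baire_prop (\bigcap_i C i)).
  by apply: comeager_bigcap => i; exact: (CP i).1.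
move=> x Cx [i _ Ax]; have [n [h|h]] := (CP i).2 x (Cx i I); exists n => y Cy.
  by exists i => //; apply: h; exact: Cy.
exfalso; apply: (h x); rewrite splice_mkseq //; exact: Cx.
Qed.

End Splice.

(** * Extracting an additive part of a continuous map *)

Section BoundedSums.
Variable R : realType.
Implicit Types a b : nat -> R.

(** For nonnegative terms this is convergence of the series, stated with finite sums in [R]; [bsumP]
    links it to the extended sum in [Erel]. *)
Definition bsum a := exists B, forall n, \sum_(0 <= k < n) a k <= B.

Lemma sum_nat_widen a m n : (m <= n)%N -> (forall k, 0 <= a k) ->
  \sum_(0 <= k < m) a k <= \sum_(0 <= k < n) a k.
Proof.
move=> mn a0; rewrite (big_cat_nat (leq0n m) mn) /= lerDl.
by apply: sumr_ge0 => k _.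
Qed.

Lemma bsum_tail a (e : R) : (forall k, 0 <= a k) -> bsum a -> 0 < e ->
  exists N, forall n, \sum_(N <= k < n) a k <= e.
Proof.
move=> a0 [B aB] e0.
pose S := range (fun n => \sum_(0 <= k < n) a k).
have hS : has_sup S by split; [exists (\sum_(0 <= k < 0) a k), 0%N|exists B => _ [n _ <-]].
have [_ [N _ <-] NS] := sup_adherent e0 hS.
exists N => n; have [nN|Nn] := leqP n N; first by rewrite big_geq// ltW.
have : \sum_(0 <= k < n) a k <= sup S by apply: (sup_upper_bound hS); exists n.
rewrite (big_cat_nat (leq0n N) (ltnW Nn))/=; lra.
Qed.

Lemma bsum_le a b (C : R) : bsum b -> 0 <= C -> (forall n, a n <= C * b n) -> bsum a.
Proof.
move=> [B bB] C0 ab; exists (C * B) => n.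
apply: le_trans (_ : \sum_(0 <= k < n) C * b k <= _); first exact: ler_sum.
by rewrite -mulr_sumr ler_wpM2l.
Qed.

Lemma bsumD a b : bsum a -> bsum b -> bsum (fun n => a n + b n).
Proof.
by move=> [A aA] [B bB]; exists (A + B) => n; rewrite big_split lerD.
Qed.

Lemma sum_geom_half n : \sum_(0 <= k < n) (2^-1 : R) ^+ k = 2 - 2 * 2^-1 ^+ n.
Proof.
elim: n => [|n IH]; first by rewrite big_geq// expr0; lra.
by rewrite big_nat_recr//= IH exprS; field.
Qed.

Lemma sum_geom_half_le n : \sum_(0 <= k < n) (2^-1 : R) ^+ k <= 2.
Proof. by rewrite sum_geom_half lerBlDr lerDl mulr_ge0// exprn_ge0// invr_ge0. Qed.

Lemma bsum_geom : bsum (fun n => 2^-1 ^+ n : R).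
Proof. by exists 2 => n; exact: sum_geom_half_le. Qed.

Lemma bsumP (a : nat -> R) : (forall n, 0 <= a n) ->
  bsum a <-> (\sum_(0 <= n <oo) (a n)%:E < +oo)%E.
Proof.
move=> a0; split=> [[B bB]|lt].
  apply: le_lt_trans (ltry B); apply: lime_le.
    by apply: is_cvg_nneseries => n _ _; rewrite lee_fin.
  by apply: nearW => n; rewrite sumEFin lee_fin.
have s0 : (0 <= \sum_(0 <= n <oo) (a n)%:E)%E.
  by apply: nneseries_ge0 => n _ _; rewrite lee_fin.
exists (fine (\sum_(0 <= n <oo) (a n)%:E)) => n.
rewrite -lee_fin -sumEFin fineK ?ge0_fin_numE//.
by apply: nneseries_lim_ge => k _ _; rewrite lee_fin.
Qed.

Lemma bsum_subseq a (N : nat -> nat) : (forall k, 0 <= a k) ->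
  (forall t, t <= N t)%N ->
  (exists B, forall t, \sum_(0 <= k < N t) a k <= B) <-> bsum a.
Proof.
move=> a0 tN; split=> -[B aB]; exists B => // n.
exact: le_trans (sum_nat_widen (tN n) a0) (aB n).
Qed.

Lemma sum_blocks a (N : nat -> nat) : N 0%N = 0%N ->
  (forall t, N t <= N t.+1)%N -> forall t,
  \sum_(0 <= k < N t) a k = \sum_(0 <= s < t) \sum_(N s <= k < N s.+1) a k.
Proof.
move=> N0 NS; elim=> [|t IH]; first by rewrite N0 !big_geq.
by rewrite big_nat_recr//= -IH (big_cat_nat (leq0n (N t))).
Qed.

Lemma bsum_blocks a (N : nat -> nat) : (forall k, 0 <= a k) ->
  N 0%N = 0%N -> (forall t, N t < N t.+1)%N ->
  bsum a <-> bsum (fun s => \sum_(N s <= k < N s.+1) a k).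
Proof.
move=> a0 N0 NS; rewrite -(@bsum_subseq a N)//; last first.
  by elim=> // t IH; exact: leq_ltn_trans IH (NS t).
by split=> -[B aB]; exists B => t; have := aB t; rewrite (sum_blocks _ N0)// => s; exact: ltnW.
Qed.

End BoundedSums.

Section FiniteExtension.

Lemma finite_bound (T : eqType) (L : seq T) (P : T -> nat -> Prop) :
  (forall i n m, (n <= m)%N -> P i n -> P i m) ->
  (forall i, i \in L -> exists n, P i n) -> exists n, forall i, i \in L -> P i n.
Proof.
move=> mP; elim: L => [|i L IH] ex; first by exists 0%N.
have [n nP] := IH (fun j jL => ex j (mem_behead (s := i :: L) jL)).
have [m mPi] := ex i (mem_head _ _).
exists (maxn n m) => j; rewrite inE => /predU1P[->|jL].
  exact: mP (leq_maxr _ _) mPi.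
exact: mP (leq_maxl _ _) (nP j jL).
Qed.

Lemma extend_all (T : eqType) (L : seq T) (Q : T -> seq nat -> Prop) :
  (forall i w w', i \in L -> Q i w -> Q i (w ++ w')) ->
  (forall i w, i \in L -> exists w', Q i (w ++ w')) ->
  forall w, exists w', forall i, i \in L -> Q i (w ++ w').
Proof.
elim: L => [|i L IH] pQ ex w; first by exists [::].
have iL : {subset L <= i :: L} by move=> j jL; rewrite inE jL orbT.
have [w1 w1P] := ex i w (mem_head _ _).
have [|j v /iL|w2 w2P] := IH _ _ (w ++ w1).
- by move=> j v v' /iL; exact: pQ.
- exact: ex.
exists (w1 ++ w2) => j; rewrite catA inE => /predU1P[->|]; last exact: w2P.
by apply: pQ => //; exact: mem_head.
Qed.

End FiniteExtension.

(** * Gauges and their quasi-triangle inequality *)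

Section Gauge.
Variable R : realType.

(** The third clause says that [f x / x] is nondecreasing, a weak form of convexity; the last one is
    a doubling condition. *)
Definition gauge (f : R -> R) (K : R) :=
  [/\ f 0 = 0,
      forall x : R, 0 <= x <= 1 -> 0 <= f x,
      forall x y : R, 0 < x -> x <= y -> y <= 1 -> f x * y <= f y * x,
      1 <= K &
      forall x : R, 0 <= x <= 1 -> f x <= K * f (x / 2)].

Variables (f : R -> R) (K : R).
Hypothesis fK : gauge f K.

Lemma gauge_le x y : 0 <= x -> x <= y -> y <= 1 -> f x <= f y.
Proof.
case: fK => f0 fge0 fmul _ _; rewrite le_eqVlt => /predU1P[<- y0 y1|x0 xy y1].
  by rewrite f0 fge0// y0.
have y0 := lt_le_trans x0 xy.
rewrite -(ler_pM2r y0) (le_trans (fmul _ _ x0 xy y1))// ler_wpM2l// fge0//.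
by rewrite ltW.
Qed.

Lemma gauge_le_lin x : 0 <= x -> x <= 1 -> f x <= f 1 * x.
Proof.
case: fK => f0 fge0 fmul _ _; rewrite le_eqVlt => /predU1P[<- _|x0 x1].
  by rewrite f0 mulr0.
by rewrite -[f x]mulr1 fmul.
Qed.

(** One of the two distances on the right is at least half of the one on the left; monotonicity and
    doubling do the rest. *)
Lemma gauge_triangle a b c : 0 <= a <= 1 -> 0 <= b <= 1 -> 0 <= c <= 1 ->
  f `|a - c| <= K * (f `|a - b| + f `|b - c|).
Proof.
move=> /andP[a0 a1] /andP[b0 b1] /andP[c0 c1].
have d1 (u v : R) : 0 <= u -> u <= 1 -> 0 <= v -> v <= 1 -> `|u - v| <= 1.
  by move=> *; rewrite ler_norml; lra.
have [_ fge0 _ K1 fK2] := fK; have K0 : 0 <= K by lra.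
have fge (u v : R) : 0 <= u -> u <= 1 -> 0 <= v -> v <= 1 -> 0 <= f `|u - v|.
  by move=> *; rewrite fge0 ?normr_ge0 ?d1.
have tri : `|a - c| <= `|a - b| + `|b - c| by rewrite ler_distD.
have h0 : 0 <= `|a - c| / 2 by rewrite divr_ge0.
apply: le_trans (fK2 _ _) _; first by rewrite normr_ge0 d1.
apply: ler_wpM2l => //.
have [h|h] := leP (`|a - c| / 2) `|a - b|.
  apply: le_trans (gauge_le h0 h (d1 _ _ _ _ _ _)) _ => //.
  by rewrite lerDl fge.
have {}h : `|a - c| / 2 <= `|b - c| by lra.
apply: le_trans (gauge_le h0 h (d1 _ _ _ _ _ _)) _ => //.
by rewrite lerDr fge.
Qed.

End Gauge.

(** * Decomposing the image into nearly independent blocks *)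

Section AdditiveBlocks.
Variables (R : realType) (f : R -> R) (K : R).
Hypothesis fK : gauge f K.
(** [h k] stands for the [k]-th coordinate of a reduction, continuous on the comeager set [G];
    [h_fin] below expresses that finite modifications of a point have equivalent images. *)
Variable h : nat -> (nat -> nat) -> R.
Hypothesis h01 : forall k x, 0 <= h k x <= 1.
Variable D : nat -> set (nat -> nat).
Let G := \bigcap_i D i.
Hypothesis oD : forall i, odense_in [::] (D i).
Hypothesis iG : splice_invariant G.
Hypothesis h_cont : forall k x (e : R), G x -> 0 < e -> exists n, forall y, G y ->
  (forall m, (m < n)%N -> y m = x m) -> `|h k x - h k y| < e.

Let dist k x y := f `|h k x - h k y|.

Hypothesis h_fin : forall x s s', bsum (fun k => dist k (splice s x) (splice s' x)).

Let f0 : f 0 = 0. Proof. by case: fK. Qed.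
Let K1 : 1 <= K. Proof. by case: fK. Qed.
Let K0 : 0 < K. Proof. exact: lt_le_trans K1. Qed.

Let diff1 k x y : 0 <= `|h k x - h k y| <= 1.
Proof.
by rewrite normr_ge0/= ler_norml; have := h01 k x; have := h01 k y; lra.
Qed.

Let dist_ge0 k x y : 0 <= dist k x y.
Proof. by case: fK => _ + _ _ _; apply. Qed.

Let distxx k x : dist k x x = 0.
Proof. by rewrite /dist subrr normr0. Qed.

Let distC k x y : dist k x y = dist k y x.
Proof. by rewrite /dist distrC. Qed.

Let dist_triangle k x y z : dist k x z <= K * (dist k x y + dist k y z).
Proof. exact: gauge_triangle. Qed.

(** Lower semicontinuity up to the factor [K]: near [x1] and [x2] each value moves by less than a
    quarter of the difference, so half of it remains, and doubling applies. *)
Let dist_lsc k x1 x2 : G x1 -> G x2 -> exists n, forall y1 y2, G y1 -> G y2 ->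
  (forall m, (m < n)%N -> y1 m = x1 m) -> (forall m, (m < n)%N -> y2 m = x2 m) ->
  dist k x1 x2 <= K * dist k y1 y2.
Proof.
move=> G1 G2; have [e|d0] := eqVneq (h k x1) (h k x2).
  exists 0%N => y1 y2 _ _ _ _; rewrite /dist e subrr normr0 f0 mulr_ge0 ?(ltW K0)//.
  exact: dist_ge0.
have e0 : 0 < `|h k x1 - h k x2| / 4 by rewrite divr_gt0// normr_gt0 subr_eq0.
have [n1 n1P] := h_cont k G1 e0; have [n2 n2P] := h_cont k G2 e0.
exists (maxn n1 n2) => y1 y2 Gy1 Gy2 a1 a2.
have {}n1P := n1P y1 Gy1 (fun m mn => a1 m (leq_trans mn (leq_maxl _ _))).
have {}n2P := n2P y2 Gy2 (fun m mn => a2 m (leq_trans mn (leq_maxr _ _))).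
have [_ _ _ _ fK2] := fK.
apply: le_trans (fK2 _ (diff1 _ _ _)) _; rewrite ler_wpM2l ?(ltW K0)//.
apply: (gauge_le fK); first by rewrite divr_ge0.
  have := ler_distD (h k y1) (h k x1) (h k x2).
  have := ler_distD (h k y2) (h k y1) (h k x2).
  rewrite (distrC (h k y2) (h k x2)); lra.
by case/andP: (diff1 k y1 y2).
Qed.

(** A category argument. If no extension made the tails uniformly small, then for each [N] a large
    tail beyond [N] would occur on a dense open subset of the cylinder, relative to [G]. A point
    lying in all of these would contradict [h_fin]. *)
Let tail_ext s1 s2 (e : R) : size s1 = size s2 -> 0 < e ->
  forall w, exists w' N, forall y, G y -> forall n,
  \sum_(N <= k < n) dist k (splice (s1 ++ w ++ w') y) (splice (s2 ++ w ++ w') y) <= e.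
Proof.
move=> sz e0 w; apply: contrapT => none.
have {none}H w' N : exists y n, G y /\
    e < \sum_(N <= k < n) dist k (splice (s1 ++ w ++ w') y) (splice (s2 ++ w ++ w') y).
  apply: contrapT => none'; apply: none; exists w', N => y Gy n.
  by rewrite leNgt; apply/negP => lt; apply: none'; exists y, n.
(* The threshold drops from [e] to [e / K] because [dist] is lower semicontinuous only up to the
   factor [K]. *)
pose Q N := [set x | G x -> exists n, e / K <
  \sum_(N <= k < n) dist k (splice s1 x) (splice s2 x)].
have [N|y yP] := @baire (s1 ++ w) (fun i => D i `&` Q i).
  apply: odense_inI; first exact/odense_inS/oD.
  move=> v; have [y [n [Gy lt]]] := H v N.
  pose x := splice (s1 ++ w ++ v) y.
  have Gx : G x by exact: iG.
  have x1 : splice s1 x = x by rewrite /x splice_cat.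
  have x2 : splice s2 x = splice (s2 ++ w ++ v) y by rewrite /x splice_swap.
  have [L LP] : exists L, forall k, k \in iota 0 n -> forall y1 y2, G y1 -> G y2 ->
      (forall m, (m < L)%N -> y1 m = x m) -> (forall m, (m < L)%N -> y2 m = splice s2 x m) ->
      dist k x (splice s2 x) <= K * dist k y1 y2.
    apply: finite_bound => [k i j ij P y1 y2 G1 G2 a1 a2|k _].
      by apply: P => // m mi; [exact: a1 (leq_trans mi ij)|exact: a2 (leq_trans mi ij)].
    by apply: dist_lsc => //; exact: iG.
  have [|w' ew'] := @mkseq_splice (s1 ++ w ++ v) y (maxn L (size (s1 ++ w ++ v))).
    exact: leq_maxr.
  exists w' => z /=; rewrite -!catA => Gz; exists n.
  rewrite ltr_pdivrMr//; apply: lt_le_trans lt _.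
  rewrite mulrC mulr_sumr big_nat_cond [leRHS]big_nat_cond.
  apply: ler_sum => k /andP[/andP[_ kn] _]; rewrite -x2.
  set z' := splice _ z.
  have z'x m : (m < maxn L (size (s1 ++ w ++ v)))%N -> z' m = x m.
    move=> mL; rewrite /z' !catA -!catA in ew' *.
    have -> : s1 ++ w ++ v ++ w' = (s1 ++ w ++ v) ++ w' by rewrite -!catA.
    rewrite -!catA -ew' /splice (set_nth_default 0%N) ?size_mkseq// nth_mkseq//.
  have z'xL m : (m < L)%N -> z' m = x m.
    by move=> mL; apply: z'x; exact: leq_trans mL (leq_maxl _ _).
  apply: LP => //; first by rewrite mem_iota.
  - by apply: iG.
  - by apply: iG.
  - move=> m mL; rewrite -x1 /splice z'xL//.
  - by move=> m mL; rewrite /splice z'xL.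
have Gx : G (splice (s1 ++ w) y) by move=> i _; exact: (yP i).1.
have [|N NP] := bsum_tail _ (h_fin (splice (s1 ++ w) y) s1 s2) (divr_gt0 e0 K0).
  by move=> k; exact: dist_ge0.
by have [n] := (yP N).2 Gx; rewrite ltNge NP.
Qed.

Let G_nonempty : exists y, G y.
Proof.
have [y yP] := baire (s := [::]) oD; exists (splice [::] y) => i _; exact: yP.
Qed.

Let head_ext s1 N (e : R) : 0 < e ->
  forall w, exists w', forall y y', G y -> G y' ->
  \sum_(0 <= k < N) dist k (splice (s1 ++ w ++ w') y) (splice (s1 ++ w ++ w') y') <= e.
Proof.
move=> e0 w; have [y0 Gy0] := G_nonempty.
have f1 : 0 <= f 1 by case: fK => _ + _ _ _; apply; rewrite ler01 lexx.
(* By [gauge_le_lin] a difference of at most [2 * d] costs at most [e / (N + 1)] in each of the [N]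
   coordinates. The 2 comes from comparing both points with [x]; the added ones keep the
   denominators positive. *)
pose d := e / (N%:R + 1) / (f 1 + 1) / 2.
have N1 : 0 < N%:R + 1 :> R by rewrite ltr_wpDl.
have d0 : 0 < d by rewrite !divr_gt0// ltr_wpDl.
pose x := splice (s1 ++ w) y0.
have Gx : G x by exact: iG.
have [L LP] : exists L, forall k, k \in iota 0 N -> forall y, G y ->
    (forall m, (m < L)%N -> y m = x m) -> `|h k x - h k y| < d.
  apply: finite_bound => [k i j ij P y Gy a|k _]; last exact: h_cont.
  by apply: P => // m mi; exact: a (leq_trans mi ij).
have [|w' ew'] := @mkseq_splice (s1 ++ w) y0 (maxn L (size (s1 ++ w))).
  exact: leq_maxr.
have ag y m : (m < L)%N -> splice (s1 ++ w ++ w') y m = x m.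
  move=> mL; have mL' := leq_trans mL (leq_maxl _ (size (s1 ++ w))).
  by rewrite catA -ew' /splice (set_nth_default 0%N) ?size_mkseq// nth_mkseq.
exists w' => y y' Gy Gy'.
apply: le_trans (_ : \sum_(0 <= k < N) e / (N%:R + 1) <= _); last first.
  rewrite sumr_const_nat subn0 -[leLHS]mulr_natl -mulrCA ger_pMr//.
  by rewrite ler_pdivrMr// mul1r lerDl.
rewrite big_nat_cond [leRHS]big_nat_cond; apply: ler_sum => k /andP[/andP[_ kN] _].
have kI : k \in iota 0 N by rewrite mem_iota.
have h1 := LP k kI _ (iG (s1 ++ w ++ w') Gy) (ag y).
have h2 := LP k kI _ (iG (s1 ++ w ++ w') Gy') (ag y').
have hh : `|h k (splice (s1 ++ w ++ w') y) - h k (splice (s1 ++ w ++ w') y')| <= 2 * d.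
  have := ler_distD (h k x) (h k (splice (s1 ++ w ++ w') y)) (h k (splice (s1 ++ w ++ w') y')).
  rewrite (distrC _ (h k x)); lra.
have /andP[u0 u1] := diff1 k (splice (s1 ++ w ++ w') y) (splice (s1 ++ w ++ w') y').
apply: le_trans (gauge_le_lin fK u0 u1) _.
apply: le_trans (ler_wpM2l f1 hh) _.
rewrite /d [2 * _]mulrC divfK// mulrCA ger_pMr ?divr_gt0//.
by rewrite ler_pdivrMr ?ltr_wpDl// mul1r lerDl.
Qed.

(** One word [w] serves all prefixes in [S] at once. It is built in three pieces: the first controls
    the tails and thereby fixes [N'], the second controls the coordinates below [N'], the third
    enters [D i]. Each property survives further extension. *)
Let stage (l : nat) (S : seq (seq nat)) N (e : R) i : 0 < e ->
  (forall s, s \in S -> size s = l) -> exists w N', (N < N')%N /\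
  [/\ forall s1 s2 y n, s1 \in S -> s2 \in S -> G y ->
        \sum_(N' <= k < n) dist k (splice (s1 ++ w) y) (splice (s2 ++ w) y) <= e,
      forall s y y', s \in S -> G y -> G y' ->
        \sum_(0 <= k < N') dist k (splice (s ++ w) y) (splice (s ++ w) y') <= e &
      forall s y, s \in S -> D i (splice (s ++ w) y)].
Proof.
move=> e0 Sl.
have [] := @extend_all _ [seq (s1, s2) | s1 <- S, s2 <- S] (fun p w => exists N, forall y n, G y ->
  \sum_(N <= k < n) dist k (splice (p.1 ++ w) y) (splice (p.2 ++ w) y) <= e) _ _ [::].
- move=> _ w w' /allpairsP[[s1 s2] [/= S1 S2 ->]] /= [M MP]; exists M => y n Gy.
  rewrite !catA -(splice_cat _ w') -(splice_swap (a := s2 ++ w) (s := s1 ++ w)).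
    by apply: MP; exact: iG.
  by rewrite !size_cat (Sl _ S1) (Sl _ S2).
- move=> _ w /allpairsP[[s1 s2] [/= S1 S2 ->]] /=.
  have [|w' [M MP]] := tail_ext (s1 := s1) (s2 := s2) _ e0 w; first by rewrite (Sl _ S1) (Sl _ S2).
  by exists w', M => y n Gy; exact: MP.
move=> w1 /= w1P.
have [] := @finite_bound _ [seq (s1, s2) | s1 <- S, s2 <- S] (fun p N => forall y n, G y ->
  \sum_(N <= k < n) dist k (splice (p.1 ++ w1) y) (splice (p.2 ++ w1) y) <= e).
- move=> p n m nm P y j Gy; have [jm|mj] := leqP j m; first by rewrite big_geq// ltW.
  apply: le_trans (P y j Gy); rewrite [leRHS](big_cat_nat nm (ltnW mj))/= lerDr.
  by apply: sumr_ge0 => k _; exact: dist_ge0.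
- exact: w1P.
move=> N1 N1P; pose N' := maxn N.+1 N1.
have [] := @extend_all _ S (fun s w => forall y y', G y -> G y' ->
  \sum_(0 <= k < N') dist k (splice (s ++ w) y) (splice (s ++ w) y') <= e) _ _ w1.
- move=> s w w' sS P y y' Gy Gy'; rewrite !catA -(splice_cat _ w' y) -(splice_cat _ w' y').
  by apply: P; exact: iG.
- by move=> s w _; exact: head_ext.
move=> w2 w2P.
have [] := @extend_all _ S (fun s w => forall y, D i (splice (s ++ w) y)) _ _ (w1 ++ w2).
- by move=> s w w' sS P y; rewrite catA -splice_cat; exact: P.
- by move=> s w sS; have [w' w'P] := odense_inS s (oD i) w; exists w'.
move=> w3 w3P; exists ((w1 ++ w2) ++ w3), N'; split; first exact: leq_maxl.
split=> [s1 s2 y n S1 S2 Gy|s y y' sS Gy Gy'|s y sS]; last exact: w3P.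
- rewrite -(catA w1) !(catA _ w1) -(splice_cat _ (w2 ++ w3)).
  rewrite -(splice_swap (a := s2 ++ w1) (s := s1 ++ w1)) ?size_cat ?(Sl _ S1) ?(Sl _ S2)//.
  set z := splice _ y; have Gz : G z by exact: iG.
  have pL : (s1, s2) \in [seq (s1, s2) | s1 <- S, s2 <- S] by apply/allpairsP; exists (s1, s2).
  have [nN|Nn] := leqP n N'; first by rewrite big_geq// ltW.
  apply: le_trans (N1P _ pL z n Gz) => /=.
  have lN : (N1 <= N')%N by exact: leq_maxr.
  rewrite [leRHS](big_cat_nat lN (ltnW Nn))/= lerDr.
  by apply: sumr_ge0 => k _; exact: dist_ge0.
- rewrite (catA s (w1 ++ w2)) -(splice_cat _ w3 y) -(splice_cat _ w3 y').
  by apply: w2P => //; exact: iG.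
Qed.

Variables (code : nat -> nat -> nat) (M : nat -> nat).

(** The sequence [x c] consists of free letters, the [t]-th one coding [c t], separated by the fixed
    words that the stages provide. Hence two such sequences differ only at free letters, which is
    what the identity for [a] expresses. *)
Lemma additive_extraction : exists (x : (nat -> nat) -> (nat -> nat)) (l N : nat -> nat),
  [/\ forall t, (t <= l t)%N,
      forall (c c' : nat -> nat) (a : nat -> nat -> R), (forall z, a z z = 0) -> forall t,
        \sum_(0 <= m < l t) a (x c m) (x c' m) =
        \sum_(0 <= s < t) a (code (c s) (M s)) (code (c' s) (M s)),
      N 0%N = 0%N /\ (forall t, (N t < N t.+1)%N) &
      forall c, (forall t, (c t <= M t)%N) -> forall t,
        \sum_(N t <= k < N t.+1) dist k (x c) (x (fun s => if s == t then c t else 0%N))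
          <= 2 * K * 2^-1 ^+ t].
Proof.
pose e t : R := 2^-1 ^+ t.
have e0 t : 0 < e t by rewrite exprn_gt0// invr_gt0.
pose cands S t := [seq rcons s (code z (M t)) | s <- S, z <- iota 0 (M t).+1].
(* The choice ranges over all triples, so a default is supplied where the candidates have no common
   length; this does not happen along [st]. *)
have /choice[step stepP] : forall q : seq (seq nat) * nat * nat, exists r : seq nat * nat,
    forall l, (forall s, s \in cands q.1.1 q.2 -> size s = l) ->
    (q.1.2 < r.2)%N /\
  [/\ forall s1 s2 y n, s1 \in cands q.1.1 q.2 -> s2 \in cands q.1.1 q.2 -> G y ->
        \sum_(r.2 <= k < n) dist k (splice (s1 ++ r.1) y) (splice (s2 ++ r.1) y) <= e q.2.+1,
      forall s y y', s \in cands q.1.1 q.2 -> G y -> G y' ->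
        \sum_(0 <= k < r.2) dist k (splice (s ++ r.1) y) (splice (s ++ r.1) y') <= e q.2.+1 &
      forall s y, s \in cands q.1.1 q.2 -> D q.2 (splice (s ++ r.1) y)].
  move=> [[S N] t] /=;
  have [[l lP]|none] := pselect (exists l, forall s, s \in cands S t -> size s = l).
    by have [w [N' ?]] := stage N t (e0 t.+1) lP; exists (w, N').
  by exists ([::], 0%N) => l lP; exfalso; apply: none; exists l.
(* [st t] holds the prefixes possible before stage [t] and the bound [N t]; [p c t] below is the
   prefix selected by [c], and [l t] the common length. *)
pose st := fix st t : seq (seq nat) * nat := if t is t'.+1 then
  let r := step (st t', t') in ([seq s ++ r.1 | s <- cands (st t').1 t'], r.2)
  else ([:: [::]], 0%N).
pose w t := (step (st t, t)).1; pose N t := (st t).2.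
pose p (c : nat -> nat) := fix p t :=
  if t is t'.+1 then rcons (p t') (code (c t') (M t')) ++ w t' else [::].
pose l := fix l t := if t is t'.+1 then ((l t').+1 + size (w t'))%N else 0%N.
have szp c t : size (p c t) = l t.
  by elim: t => //= t IH; rewrite size_cat size_rcons IH.
have szst t s : s \in (st t).1 -> size s = l t.
  elim: t s => [|t IH] s; first by rewrite inE => /eqP ->.
  move=> /mapP[s' /allpairsP[[s1 z] [/= s1S _ ->]] ->].
  by rewrite size_cat size_rcons (IH _ s1S).
have szc t (s : seq nat) : s \in cands (st t).1 t -> size s = (l t).+1.
  by move=> /allpairsP[[s1 z] [/= s1S _ ->]]; rewrite size_rcons (szst t s1).
have tl t : (t <= l t)%N by elim: t => //= t IH; rewrite addSn ltnS (leq_trans IH) ?leq_addr.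
(* Beyond [N t] the image hardly depends on the first [t] free coordinates,
   and below [N t] it hardly depends on the others. *)
have tailP t s1 s2 y n : s1 \in (st t).1 -> s2 \in (st t).1 -> G y ->
    \sum_(N t <= k < n) dist k (splice s1 y) (splice s2 y) <= e t.
  case: t => [|t].
    rewrite !inE => /eqP -> /eqP -> _; rewrite big1 => [|k _]; last exact: distxx.
    exact: ltW.
  move=> /mapP[s1' s1c ->] /mapP[s2' s2c ->].
  by have [_ [+ _ _]] := stepP (st t, t) _ (szc t); apply.
have headP t s y y' : s \in (st t).1 -> G y -> G y' ->
    \sum_(0 <= k < N t) dist k (splice s y) (splice s y') <= e t.
  case: t => [|t]; first by move=> *; rewrite big_geq// ltW.
  move=> /mapP[s1' s1c ->].
  by have [_ [_ + _]] := stepP (st t, t) _ (szc t); apply.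
have pS c t : exists r, p c t.+1 = p c t ++ r.
  by exists (code (c t) (M t) :: w t); rewrite /= cat_rcons.
have /choice[x xP] : forall c, exists x, forall i y, (forall m, (l i <= m)%N -> x m = y m) ->
     x = splice (p c i) y.
  move=> c; have [||x xP] := @limit_prefix (p c) => [i|i|]; rewrite ?szp//.
  by exists x => i y; rewrite -(szp c i); exact: xP.
have xE c t : x c = splice (p c t) (x c) by exact: xP.
have p_cand c t : (forall s, c s <= M s)%N -> p c t \in (st t).1 ->
    rcons (p c t) (code (c t) (M t)) \in cands (st t).1 t.
  move=> cM pc; apply/allpairsP; exists (p c t, c t); split=> //.
  by rewrite mem_iota add0n ltnS; exact: cM.
have p_st c t : (forall s, c s <= M s)%N -> p c t \in (st t).1.
  by move=> cM; elim: t => [|t IH]; rewrite ?inE//=; apply: map_f; exact: p_cand.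
have Gx c : (forall s, c s <= M s)%N -> G (x c).
  move=> cM t _; rewrite (xE c t.+1) /=.
  have [_ [_ _ +]] := stepP (st t, t) _ (szc t); apply; exact: p_cand (p_st _ _ cM).
have px c c' t : (forall s, (t <= s)%N -> c s = c' s) -> forall m, (l t <= m)%N -> x c m = x c' m.
  move=> cc' m lm.
  have [r [e1 e2]] : exists r, p c (t + m.+1)%N = p c t ++ r /\ p c' (t + m.+1)%N = p c' t ++ r.
    elim: (m.+1) => [|u [r [e1 e2]]]; first by exists [::]; rewrite addn0 !cats0.
    exists (r ++ code (c (t + u)%N) (M (t + u)%N) :: w (t + u)%N).
    by rewrite addnS /= !cat_rcons e1 e2 !catA cc'// leq_addr.
  have mr : (m - l t < size r)%N.
    rewrite ltn_subLR// -(szp c t) -size_cat -e1 szp.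
    by apply: leq_trans (tl _); rewrite leq_addl.
  rewrite (xE c (t + m.+1)%N) (xE c' (t + m.+1)%N) e1 e2 /splice !nth_cat !szp ltnNge lm /=.
  exact: set_nth_default.
exists x, l, N; split=> //.
- move=> c c' a az; elim=> [|t IH]; first by rewrite !big_geq.
  rewrite [RHS]big_nat_recr//= -IH.
  rewrite (big_cat_nat (leq0n (l t)))/=; last by rewrite addSn leqW// leq_addr.
  congr (_ + _); rewrite big_ltn; last by rewrite addSn ltnS leq_addr.
  rewrite (xE c t.+1) (xE c' t.+1) /= /splice !cat_rcons !nth_cat !szp ltnn subnn /=.
  (* Strictly between [l t] and [l t.+1] both sequences carry the fixed word [w t], so these terms
     vanish. *)
  rewrite [X in _ + X]big_nat_cond big1 ?addr0// => m /andP[/andP[lm ml] _].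
  rewrite !nth_cat !szp ltnNge (ltnW lm) /=.
  have [i ei] : exists i, (m - l t)%N = i.+1 by exists (m - l t).-1; rewrite prednK// subn_gt0.
  rewrite ei /= (set_nth_default (x c m)) ?az// -ltnS -ei ltn_subLR ?(ltnW lm)//.
  by rewrite addnS -addSn.
- split=> // t; have [] := stepP (st t, t) _ (szc t) => //.
- move=> c cM t.
  (* Pass through [c1]. It shares with [c] the choices up to [t], so [headP] applies below [N t.+1];
     it shares with [c2] the choices from [t] on, so [tailP] applies beyond [N t]. *)
  pose c1 s := if (s <= t)%N then c s else 0%N.
  pose c2 s := if s == t then c t else 0%N.
  have c1M s : (c1 s <= M s)%N by rewrite /c1; case: ifP.
  have c2M s : (c2 s <= M s)%N by rewrite /c2; case: eqP => [->|].
  have pc1 : p c1 t.+1 = p c t.+1.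
    suff H i : (i <= t.+1)%N -> p c1 i = p c i by exact: H.
    by elim: i => //= i IH it; rewrite IH ?(ltnW it)// /c1 -ltnS it.
  have h1 : \sum_(N t <= k < N t.+1) dist k (x c) (x c1) <= e t.
    have NN : (N t <= N t.+1)%N.
      by have [/ltnW] := stepP (st t, t) _ (szc t).
    apply: le_trans (_ : e t.+1 <= _); last first.
      by rewrite /e exprS ger_pMl ?exprn_gt0 ?invr_gt0//; lra.
    apply: le_trans (headP t.+1 (p c t.+1) (x c) (x c1) (p_st _ _ cM) (Gx _ cM) (Gx _ c1M)).
    rewrite -xE -pc1 -xE [leRHS](big_cat_nat (leq0n (N t)) NN)/= lerDr.
    by apply: sumr_ge0 => k _; exact: dist_ge0.
  have h2 : \sum_(N t <= k < N t.+1) dist k (x c1) (x c2) <= e t.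
    have -> : x c2 = splice (p c2 t) (x c1).
      apply: xP => m lm; apply: (px _ _ t) => // s ts; rewrite /c1 /c2.
      by case: eqP => [->|]; rewrite ?leqnn//; case: leqP => // st' ne; exfalso; lia.
    by rewrite {1}(xE c1 t); apply: tailP; [exact: p_st|exact: p_st|exact: Gx].
  apply: le_trans (_ : \sum_(N t <= k < N t.+1)
    K * (dist k (x c) (x c1) + dist k (x c1) (x c2)) <= _).
    by apply: ler_sum => k _; exact: dist_triangle.
  rewrite -mulr_sumr big_split /= (mulrC 2) -mulrA ler_wpM2l ?(ltW K0)//.
  rewrite -/(e t); lra.
Qed.

End AdditiveBlocks.

(** * Non-reducibility *)

Section Selection.
Variable R : realType.
Implicit Types a : nat -> R.

Lemma bsum_finite a n : (forall k, 0 <= a k) -> (forall k, (n <= k)%N -> a k = 0) -> bsum a.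
Proof.
move=> a0 an; exists (\sum_(0 <= k < n) a k) => m; have [mn|/ltnW nm] := leqP m n.
  exact: sum_nat_widen.
have z : \sum_(n <= k < m) a k = 0.
  by rewrite big_nat_cond big1// => k /andP[/andP[nk _] _]; exact: an.
by rewrite (big_cat_nat (leq0n n) nm)/= z addr0.
Qed.

(** Select [t] when [a t] is below [2^-s], where [s] counts the earlier selections. The selected
    terms are dominated by a geometric series, and smallness infinitely often keeps the selection
    going. *)
Lemma summable_selection a :
  (forall j t0, exists2 t, (t0 <= t)%N & a t < 2^-1 ^+ j) ->
  exists2 sel : nat -> bool, bsum (fun t => if sel t then a t else 0) &
    ~ bsum (fun t => (sel t)%:R : R).
Proof.
move=> small.
pose s := fix s t := if t is u.+1 then (s u + (a u < 2^-1 ^+ s u)%R)%N else 0%N.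
have sS t : s t.+1 = (s t + (a t < 2^-1 ^+ s t)%R)%N by [].
have s_le t u : (t <= u)%N -> (s t <= s u)%N.
  move=> /subnK <-; elim: (u - t)%N => // n IH.
  by rewrite addSn sS (leq_trans IH)// leq_addr.
exists (fun t => a t < 2^-1 ^+ s t).
  exists 2 => n; apply: le_trans (_ : 2 - 2 * 2^-1 ^+ s n <= 2); last first.
    by rewrite lerBlDr lerDl mulr_ge0// exprn_ge0// invr_ge0.
  elim: n => [|n IH]; first by rewrite big_geq// expr0; lra.
  rewrite big_nat_recr//=; case: ifPn => [an|_]; last by rewrite addr0 addn0.
  by rewrite addn1 exprS mulrA divff// mul1r; lra.
move=> [B bB].
have sums n : \sum_(0 <= t < n) (a t < 2^-1 ^+ s t)%R%:R = (s n)%:R :> R.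
  elim: n => [|n IH]; first by rewrite big_geq.
  by rewrite big_nat_recr//= IH natrD.
have unb j : exists t, (j <= s t)%N.
  elim: j => [|j [t jt]]; first by exists 0%N.
  have [u tu au] := small j t; have [ju|] := ltnP j (s u); first by exists u.
  move=> uj; have su : s u = j by apply/eqP; rewrite eqn_leq uj (leq_trans jt)// s_le.
  by exists u.+1; rewrite sS su au addn1.
have [t] := unb (Num.truncn `|B|).+1.
have := bB t; rewrite sums => sB /(conj (truncnS_gt `|B|)) [].
rewrite -(ler_nat R) => h1 h2; have := ler_norm B; lra.
Qed.

Lemma argmax_nat (b : nat -> R) n : (0 < n)%N ->
  exists2 i, (i < n)%N & forall j, (j < n)%N -> b j <= b i.
Proof.
case: n => // n _; elim: n => [|n [i ii ib]].
  by exists 0%N => // j; rewrite ltnS leqn0 => /eqP ->.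
have [h|h] := leP (b i) (b n.+1).
  exists n.+1 => // j; rewrite ltnS leq_eqVlt => /predU1P[->//|/ib] /le_trans; exact.
exists i; first exact: ltnW.
by move=> j; rewrite ltnS leq_eqVlt => /predU1P[->|/ib//]; exact: ltW.
Qed.

(* [f] lies above the line through [(b, 0)] of slope [f b / b]; summing this
   over the steps, with [b] half of the average step, gives the bound. *)
Lemma gauge_chain (f : R -> R) K (tau : R) (d : nat -> R) M : gauge f K ->
  0 <= tau <= 1 -> (0 < M)%N -> (forall i, 0 <= d i <= 1) ->
  tau <= \sum_(0 <= i < M) d i ->
  M%:R * f (tau / M%:R) <= K * \sum_(0 <= i < M) f (d i).
Proof.
move=> fK /andP[tau0 tau1] M0 d01 taud.
have [f0 fge0 fmul K1 fhalf] := fK.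
have K0 : 0 <= K by lra.
have sge0 : 0 <= \sum_(0 <= i < M) f (d i) by apply: sumr_ge0 => i _; exact: fge0.
have M0R : 0 < M%:R :> R by rewrite ltr0n.
have M1R : 1 <= M%:R :> R by rewrite ler1n.
move: tau0; rewrite le_eqVlt => /predU1P[<-|tau0].
  by rewrite mul0r f0 mulr0 mulr_ge0.
have a1 : tau / M%:R <= 1 by rewrite ler_pdivrMr// mul1r (le_trans tau1).
have a0 : 0 < tau / M%:R by rewrite divr_gt0.
pose b := tau / M%:R / 2.
have b0 : 0 < b by rewrite divr_gt0.
have Mb : M%:R * b = tau / 2 by rewrite /b; field; rewrite gt_eqF.
apply: le_trans (_ : M%:R * (K * f b) <= _).
  by rewrite ler_wpM2l ?(ltW M0R)// fhalf// (ltW a0) a1.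
rewrite mulrCA ler_wpM2l//.
have b1 : b <= 1 by rewrite /b; lra.
have fb0 : 0 <= f b by rewrite fge0// (ltW b0).
have line i : f b * (d i - b) <= b * f (d i).
  have /andP[di0 di1] := d01 i.
  have [h|h] := leP b (d i).
    apply: le_trans (_ : f b * d i <= _); last by rewrite (mulrC b) fmul.
    by rewrite ler_wpM2l// lerBlDr lerDl ltW.
  apply: le_trans (_ : 0 <= _); last by rewrite mulr_ge0 ?(ltW b0)// fge0// d01.
  by rewrite mulr_ge0_le0// subr_le0 ltW.
rewrite -(ler_pM2l b0) mulr_sumr.
apply: le_trans (_ : \sum_(0 <= i < M) f b * (d i - b) <= _); last exact: ler_sum.
rewrite -mulr_sumr sumrB sumr_const_nat subn0 -[b *+ M]mulr_natl Mb.
rewrite mulrA (mulrC b) Mb mulrC ler_wpM2l//; lra.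
Qed.

End Selection.

(** * The Hilbert cube and Borel maps on it *)

Section Cube.
Variable R : realType.

Lemma ErelE (f : unit_itv R -> R) (x y : hilbert_cube R) : (forall z, 0 <= f z) ->
  Erel f x y <-> bsum (fun n => f (unit_dist (x n) (y n))).
Proof.
move=> f0; apply: iff_sym; exact: (bsumP (fun n => f0 (unit_dist (x n) (y n)))).
Qed.

Lemma cvg_cube (F : set_system (hilbert_cube R)) (x : hilbert_cube R) : Filter F ->
  (forall i, (fun y : hilbert_cube R => y i) @ F --> x i) -> F --> x.
Proof.
move=> FF Fx; apply/cvg_sup => i A [B [[C oC <-] Cx] CA].
by apply: filterS CA _; apply: (Fx i); exact: open_nbhs_nbhs.
Qed.

Lemma cube_coord_continuous i : continuous (fun y : hilbert_cube R => y i).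
Proof. exact: (@proj_continuous nat (fun=> unit_itv R) i). Qed.

Lemma open_coord_gt k (r : R) : open [set y : hilbert_cube R | r < val (y k)].
Proof.
have vc : continuous (val : unit_itv R -> R) by exact: initial_continuous.
have : continuous (fun y : hilbert_cube R => val (y k)).
  by move=> y; apply: continuous_comp; [exact: cube_coord_continuous|exact: vc].
by move=> /continuousP/(_ _ (@open_gt _ r)).
Qed.

Lemma continuous_borel_fun (X Y : topologicalType) (theta : X -> Y) :
  continuous theta -> borel_fun theta.
Proof.
move=> /continuousP ct B sB; apply: (sB [set B | <<s open >> (theta @^-1` B)]); split=> /=.
  split=> [|A sA|A sA] /=.
  - by rewrite preimage_set0; exact: sigma_algebra0.
  - by rewrite setTD preimage_setC -setTD; exact: sigma_algebraCD.
  - by rewrite preimage_bigcup; exact: sigma_algebra_bigcup.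
by move=> A oA; apply: sub_sigma_algebra; exact: ct.
Qed.

(* The numbers coding a pair [(a, b)] with [a <= b] name the fraction [a / b]. *)
Definition code_frac (n : nat) : R :=
  if unpickle n is Some (a, b) then (if (a <= b)%N then a%:R / b%:R else 0) else 0.

Lemma frac_subproof n : code_frac n \in (`[0, 1]%classic : set R).
Proof.
apply/mem_set; rewrite /= in_itv /= /code_frac.
case: unpickle => [[a b]|]; last by rewrite lexx ler01.
case: ifP => ab; last by rewrite lexx ler01.
rewrite divr_ge0//=; case: b ab => [|b] ab; first by rewrite invr0 mulr0 ler01.
by rewrite ler_pdivrMr ?ltr0n// mul1r ler_nat.
Qed.

Definition frac_itv n : unit_itv R := exist _ (code_frac n) (frac_subproof n).

Lemma frac_code a b : (a <= b)%N -> code_frac (pickle (a, b)) = a%:R / b%:R.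
Proof. by move=> ab; rewrite /code_frac pickleK ab. Qed.

(** A continuous map from sequences of naturals to points with rational coordinates; the category
    arguments take place on its domain rather than in the cube. *)
Definition frac_cube (x : nat -> nat) : hilbert_cube R := fun n => frac_itv (x n).

Lemma open_frac_cube (W : set (hilbert_cube R)) x : open W -> W (frac_cube x) ->
  exists n, forall y, (forall m, (m < n)%N -> y m = x m) -> W (frac_cube y).
Proof.
move=> oW Wx.
pose F : set_system (hilbert_cube R) := filter_from [set: nat]
  (fun n => frac_cube @` [set y | forall m, (m < n)%N -> y m = x m]).
have FF : Filter F.
  apply: filter_from_filter; first by exists 0%N.
  move=> i j _ _; exists (maxn i j) => // _ [y yx <-]; split; exists y => // m mi;
    by apply: yx; rewrite (leq_trans mi)// (leq_maxl, leq_maxr).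
have /(_ W) : F --> frac_cube x.
  apply: cvg_cube => i A /nbhs_singleton Ax; exists i.+1 => // _ [y yx <-] /=.
  by rewrite /frac_cube yx.
case; first exact: open_nbhs_nbhs.
by move=> n _ nW; exists n => y yx; apply: nW; exists y.
Qed.

Lemma borel_baire_prop (B : set (hilbert_cube R)) :
  <<s open >> B -> baire_prop (frac_cube @^-1` B).
Proof.
move=> sB; apply: (sB [set B | baire_prop (frac_cube @^-1` B)]); split=> /=.
  split=> [|A sA|A sA] /=.
  - rewrite preimage_set0; apply: (@rel_open_baire_prop setT) => //.
    by apply: odense_comeager => w; exists [::].
  - by rewrite setTD preimage_setC; exact: baire_propC.
  - by rewrite preimage_bigcup; exact: baire_prop_bigcup.
move=> A oA /=; apply: (@rel_open_baire_prop setT).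
  by apply: odense_comeager => w; exists [::].
move=> x _ Ax; have [n nA] := open_frac_cube oA Ax; exists n => y _; apply: nA => m mn.
by rewrite /splice (set_nth_default 0%N) ?size_mkseq// nth_mkseq.
Qed.

(** The countably many sets where coordinate [k] exceeds [i / (p + 1)] have the Baire property. On a
    common comeager set they are decided locally, and finitely many [i] determine the coordinate up
    to [1 / (p + 1)]. *)
Lemma borel_continuous_comeager (theta : hilbert_cube R -> hilbert_cube R) :
  borel_fun theta -> exists D : nat -> set (nat -> nat),
  [/\ forall i, odense_in [::] (D i), splice_invariant (\bigcap_i D i) &
   forall k x (e : R), (\bigcap_i D i) x -> 0 < e -> exists n, forall y, (\bigcap_i D i) y ->
  (forall m, (m < n)%N -> y m = x m) ->
   `|val (theta (frac_cube x) k) - val (theta (frac_cube y) k)| < e].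
Proof.
move=> bt; pose h k x := val (theta (frac_cube x) k).
pose A (q : nat * nat * nat) := [set x | q.2%:R / q.1.2.+1%:R < h q.1.1 x].
have /choice[C CP] : forall q, exists C, comeager C /\ decided_in C (A q).
  move=> q; suff [C] : baire_prop (A q) by exists C.
  apply: (borel_baire_prop (B := theta @^-1` [set y | q.2%:R / q.1.2.+1%:R < val (y q.1.1)])).
  by apply: bt; apply: sub_sigma_algebra; exact: open_coord_gt.
have /comeager_invariant[D oD [DC iD]] := comeager_bigcap (fun q => (CP q).1).
exists D; split=> // k x e Gx e0.
pose p := Num.truncn e^-1.
have pe : p.+1%:R^-1 < e.
  by rewrite invf_plt ?posrE// ?ltr0n//; exact: truncnS_gt.
have [n nP] : exists n, forall i, i \in iota 0 p.+2 -> forall y, (\bigcap_i D i) y ->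
    (forall m, (m < n)%N -> y m = x m) -> (A (k, p, i) x <-> A (k, p, i) y).
  apply: finite_bound => [i n m nm P y Gy yx|i _].
    by apply: P => // j jn; apply: yx; exact: leq_trans nm.
  have Cx : C (k, p, i) x by exact: DC.
  have [n [nA|nA]] := (CP (k, p, i)).2 x Cx; exists n => y Gy yx.
    have ey : splice (mkseq x n) y = y.
      rewrite -{2}(splice_mkseq y n); congr (splice _ _).
      by apply/eq_in_map => j; rewrite mem_iota => /yx.
    have := nA x; rewrite splice_mkseq => /(_ Cx) Ax.
    have := nA y; rewrite ey => /(_ (DC _ Gy _ I)) Ay; by [].
  have ey : splice (mkseq x n) y = y.
    rewrite -{2}(splice_mkseq y n); congr (splice _ _).
    by apply/eq_in_map => j; rewrite mem_iota => /yx.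
  have := nA x; rewrite splice_mkseq => /(_ Cx) Ax.
  by have := nA y; rewrite ey => /(_ (DC _ Gy _ I)) Ay.
exists n => y Gy yx.
have hI z : 0 <= h k z <= 1.
  by rewrite /h; case: (theta _ k) => v /= /set_mem; rewrite /= in_itv.
have p0 : 0 < p.+1%:R :> R by rewrite ltr0n.
(* If the values differed by more than [1 / (p + 1)], a multiple of it would separate them. *)
have key u v : 0 <= h k u -> h k v <= 1 ->
    (forall i, i \in iota 0 p.+2 -> A (k, p, i) v -> A (k, p, i) u) -> h k v - h k u <= p.+1%:R^-1.
  move=> u0 v1 uv; rewrite leNgt; apply/negP => lt.
  pose i := (Num.truncn (h k u * p.+1%:R)).+1.
  have iu : h k u < i%:R / p.+1%:R by rewrite ltr_pdivlMr// truncnS_gt.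
  have iv : i%:R / p.+1%:R < h k v.
    apply: le_lt_trans (_ : h k u + p.+1%:R^-1 < _); last by rewrite addrC -ltrBrDr.
    rewrite ler_pdivrMr// mulrDl mulVf ?gt_eqF// /i -natr1 lerD2r.
    by rewrite truncn_le// mulr_ge0// ltW.
  have ip : (i <= p.+1)%N.
    by rewrite -(ler_nat R) -[leRHS]mul1r -ler_pdivrMr//; exact: ltW (lt_le_trans iv v1).
  have := uv i; rewrite mem_iota add0n ltnS => /(_ ip iv) /lt_trans/(_ iu); by rewrite ltxx.
apply: le_lt_trans _ pe; have /andP[x0 x1] := hI x; have /andP[y0 y1] := hI y.
rewrite -/(h k x) -/(h k y) ler_norml; apply/andP; split.
  rewrite lerNl opprB.
  by apply: key => // i ii /nP; apply.
by apply: key => // i ii /nP; apply.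
Qed.

End Cube.

(** * A necessary condition for reducibility *)

Section NonReduction.
Variables (R : realType) (f g : R -> R) (K K' : R).
Hypothesis fK : gauge f K.
Hypothesis f_mul : forall x y : R, 0 < x <= 1 -> 0 < y <= 1 -> f x * f y <= K' * f (x * y).
Hypothesis K'0 : 0 <= K'.
Hypothesis g0 : g 0 = 0.
Hypothesis g_ge0 : forall x : R, 0 <= x <= 1 -> 0 <= g x.
Hypothesis g1 : 0 < g 1.

Lemma reduction_bsum :
  borel_le (Erel (fun x : unit_itv R => g (val x))) (Erel (fun x : unit_itv R => f (val x))) ->
  forall M : nat -> nat, (forall t, 0 < M t)%N ->
  bsum (fun t => g (M t)%:R^-1) -> bsum (fun t => f (M t)%:R^-1).
Proof.
move=> [theta bt tE] M M0 gM.
have [f0 f_ge0 _ K1 _] := fK; have K0 : 0 <= K by lra.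
have itv01 (z : unit_itv R) : 0 <= val z <= 1.
  by case: z => v /= /set_mem; rewrite /= in_itv.
have [D [oD iD hc]] := borel_continuous_comeager bt.
pose h k x := val (theta (frac_cube R x) k).
pose dist k x y := f `|h k x - h k y|.
have h01 k x : 0 <= h k x <= 1 by exact: itv01.
have E_iff x y : bsum (fun m => g `|code_frac R (x m) - code_frac R (y m)|) <->
    bsum (fun k => dist k x y).
  have := tE (frac_cube R x) (frac_cube R y).
  rewrite !ErelE; [|by move=> z; rewrite f_ge0|by move=> z; rewrite g_ge0].
  rewrite /= /dist /h.
  have dC (a : R -> R) (u v : nat -> R) :
    (fun n => a `|u n - v n|) = (fun n => a `|v n - u n|).
    by apply/funext => n; rewrite distrC.
  move=> H; rewrite (dC g (fun m => code_frac R (x m))).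
  by rewrite (dC f (fun k => val (theta (frac_cube R x) k))).
have d01 k x y : 0 <= `|h k x - h k y| <= 1.
  by rewrite normr_ge0/= ler_norml; have := h01 k x; have := h01 k y; lra.
have dist_ge0 k x y : 0 <= dist k x y by exact: f_ge0.
have distC k x y : dist k x y = dist k y x by rewrite /dist distrC.
have fr01 m : 0 <= code_frac R m <= 1 by exact: (itv01 (frac_itv R m)).
have fin x s s' : bsum (fun k => dist k (splice s x) (splice s' x)).
  apply/E_iff; apply: (@bsum_finite _ _ (maxn (size s) (size s'))) => k.
    apply: g_ge0; rewrite normr_ge0/= ler_norml.
    by have := fr01 (splice s x k); have := fr01 (splice s' x k); lra.
  by rewrite geq_max => /andP[ks ks']; rewrite !splice_ge// subrr normr0.
have [x [l [N [tl l_sum [N0 NS] N_err]]]] := additive_extraction fK h01 oD iD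
  hc fin (fun z m => pickle (z, m)) M.
(* [B t z z'] measures how far the [t]-th block of the image moves when the [t]-th free coordinate
   goes from [z / M t] to [z' / M t] and all others are 0. *)
pose e t z : nat -> nat := fun s => if s == t then z else 0%N.
pose B t z z' := \sum_(N t <= k < N t.+1) dist k (x (e t z)) (x (e t z')).
have B_ge0 t z z' : 0 <= B t z z' by apply: sumr_ge0.
(* Replacing [c] by its [t]-th entry alone changes the [t]-th block by a summable error, so
   equivalence of the images can be tested block by block with [B]. *)
have B_iff c c' : (forall t, c t <= M t)%N -> (forall t, c' t <= M t)%N ->
    bsum (fun t => g `|(c t)%:R / (M t)%:R - (c' t)%:R / (M t)%:R|) <->
    bsum (fun t => B t (c t) (c' t)).
  move=> cM c'M.
  pose err t : R := 2 * K * 2^-1 ^+ t.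
  have berr : bsum err by apply: bsum_le (bsum_geom R) _ (fun=> lexx _); lra.
  pose A t := \sum_(N t <= k < N t.+1) dist k (x c) (x c').
  have AB t : A t <= K * K * (B t (c t) (c' t) + (err t + err t)).
    apply: le_trans (_ : \sum_(N t <= k < N t.+1) K * K * (dist k (x (e t (c t))) (x (e t (c' t))) +
      (dist k (x c) (x (e t (c t))) + dist k (x c') (x (e t (c' t))))) <= _).
      apply: ler_sum => k _.
      have t1 := gauge_triangle fK (h01 k (x c)) (h01 k (x (e t (c t)))) (h01 k (x c')).
      have t2 := gauge_triangle fK (h01 k (x (e t (c t)))) (h01 k (x (e t (c' t)))) (h01 k (x c')).
      apply: le_trans t1 _; rewrite -mulrA ler_wpM2l//.
      apply: le_trans (_ : K * dist k (x c) (x (e t (c t))) +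
        K * (dist k (x (e t (c t))) (x (e t (c' t))) + dist k (x (e t (c' t))) (x c')) <= _).
        by apply: lerD _ t2; rewrite ler_peMl//; exact: dist_ge0.
      by rewrite (distC _ _ (x c')) -mulrDr ler_wpM2l//; lra.
    rewrite -mulr_sumr !big_split /= ler_wpM2l ?mulr_ge0// lerD2l.
    by apply: lerD; exact: N_err.
  have BA t : B t (c t) (c' t) <= K * K * (A t + (err t + err t)).
    apply: le_trans (_ : \sum_(N t <= k < N t.+1) K * K * (dist k (x c) (x c') +
      (dist k (x c) (x (e t (c t))) + dist k (x c') (x (e t (c' t))))) <= _).
      apply: ler_sum => k _.
      have t1 := gauge_triangle fK (h01 k (x (e t (c t)))) (h01 k (x c)) (h01 k (x (e t (c' t)))).
      have t2 := gauge_triangle fK (h01 k (x c)) (h01 k (x c')) (h01 k (x (e t (c' t)))).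
      apply: le_trans t1 _; rewrite -mulrA ler_wpM2l//.
      apply: le_trans (_ : K * dist k (x (e t (c t))) (x c) +
        K * (dist k (x c) (x c') + dist k (x c') (x (e t (c' t)))) <= _).
        by apply: lerD _ t2; rewrite ler_peMl//; exact: dist_ge0.
      by rewrite (distC _ (x (e t _))) -mulrDr ler_wpM2l//; lra.
    rewrite -mulr_sumr !big_split /= ler_wpM2l ?mulr_ge0// lerD2l.
    by apply: lerD; exact: N_err.
  have -> : bsum (fun t => B t (c t) (c' t)) <-> bsum A.
    by split=> bs; [apply: bsum_le _ _ AB|apply: bsum_le _ _ BA]; rewrite ?mulr_ge0//;
      do 2?apply: bsumD.
  rewrite -(bsum_blocks (fun k => dist_ge0 k (x c) (x c')) N0 NS) -E_iff.
  rewrite -(@bsum_subseq _ (fun m => g `|code_frac R (x c m) - code_frac R (x c' m)|) l)//;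
    last first.
    move=> m; apply: g_ge0; rewrite normr_ge0/= ler_norml.
    by have := fr01 (x c m); have := fr01 (x c' m); lra.
  have gz z : g `|code_frac R z - code_frac R z| = 0 by rewrite subrr normr0.
  have ls t := l_sum c c' (fun u v => g `|code_frac R u - code_frac R v|) gz t.
  have -> : (fun t => g `|(c t)%:R / (M t)%:R - (c' t)%:R / (M t)%:R|) =
     (fun t => g `|code_frac R (pickle (c t, M t)) - code_frac R (pickle (c' t, M t))|).
    by apply/funext => t; rewrite !frac_code.
  by split=> -[b bP]; exists b => t; have := bP t; rewrite ls.
(* [i t] is the step of length [1 / M t] that moves the block most. Even these worst steps are
   summable, since they join two points equivalent for [g]. *)
have /choice[i iP] : forall t, exists i,
    (i < M t)%N /\ forall j, (j < M t)%N -> B t j j.+1 <= B t i i.+1.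
  by move=> t; have [i] := argmax_nat (fun i => B t i i.+1) (M0 t); exists i.
have bD : bsum (fun t => B t (i t) (i t).+1).
  apply/(B_iff i (fun t => (i t).+1)) => [t|t|]; [exact: ltnW (iP t).1|exact: (iP t).1|].
  have -> : (fun t => g `|(i t)%:R / (M t)%:R - (i t).+1%:R / (M t)%:R|) =
      (fun t => g (M t)%:R^-1) => //.
  apply/funext => t; congr g; rewrite -mulrBl -natr1 opprD addrA subrr add0r mulN1r normrN.
  by rewrite ger0_norm// invr_ge0.
(* In each coordinate [gauge_chain] bounds the displacement [tau] of the whole path by its [M t]
   steps, and [f_mul] separates [f tau] from [f (1 / M t)]. Summing over the block, each step is at
   most the worst one. *)
have BM t : B t 0 (M t) * f (M t)%:R^-1 <= K' * K * B t (i t) (i t).+1.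
  have Mt : 0 < (M t)%:R :> R by rewrite ltr0n.
  have M1 : 0 < ((M t)%:R^-1 : R) <= 1 by rewrite invr_gt0 Mt/= invf_le1// ler1n.
  rewrite -(ler_pM2l Mt).
  apply: le_trans (_ : \sum_(N t <= k < N t.+1)
    K' * (K * \sum_(0 <= j < M t) dist k (x (e t j)) (x (e t j.+1))) <= _).
    rewrite mulrC -mulrA mulr_suml; apply: ler_sum => k _.
    set tau := `|h k (x (e t 0)) - h k (x (e t (M t)))|.
    have tau01 : 0 <= tau <= 1 by exact: d01.
    have chain : (M t)%:R * f (tau / (M t)%:R) <=
        K * \sum_(0 <= j < M t) dist k (x (e t j)) (x (e t j.+1)).
      apply: (gauge_chain fK tau01 (M0 t) (fun j => d01 k _ _)).
      rewrite /tau; elim: (M t) => [|m IH]; first by rewrite subrr normr0 big_geq.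
      rewrite big_nat_recr//=; apply: le_trans (ler_distD (h k (x (e t m))) _ _) _.
      by rewrite lerD2r.
    apply: le_trans (ler_wpM2l K'0 chain).
    rewrite mulrA mulrCA [leRHS]mulrC ler_wpM2r ?(ltW Mt)//.
    have /andP[] := tau01; rewrite le_eqVlt => /predU1P[e0 _|t0 t1].
      by rewrite /dist -/tau -e0 mul0r f0 mul0r mulr0.
    by apply: f_mul => //; rewrite t0.
  rewrite -!mulr_sumr mulrA [leRHS]mulrCA ler_wpM2l ?mulr_ge0//.
  rewrite exchange_big /= mulr_natl.
  rewrite -[X in _ *+ X](subn0 (M t)) -sumr_const_nat.
  rewrite big_nat_cond [leRHS]big_nat_cond; apply: ler_sum => j /andP[/andP[_ jM] _].
  exact: (iP t).2.
have bBf : bsum (fun t => B t 0 (M t) * f (M t)%:R^-1).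
  by apply: bsum_le bD _ BM; rewrite mulr_ge0.
have fM_ge0 t : 0 <= f (M t)%:R^-1.
  by apply: f_ge0; rewrite invr_ge0 ler0n/= invf_le1 ?ltr0n// ler1n.
(* If the whole displacements are eventually bounded below, they can be divided out. Otherwise
   infinitely many of them have a finite sum, and moving those coordinates from 0 to 1 gives
   equivalent images of inequivalent points. *)
have [[j [t0 small]]|big_] := pselect
    (exists j t0, forall t, (t0 <= t)%N -> 2^-1 ^+ j <= B t 0 (M t)).
  have j0 : 0 < 2^-1 ^+ j :> R by rewrite exprn_gt0// invr_gt0.
  pose b t := if (t < t0)%N then f (M t)%:R^-1 else 0.
  have bb : bsum b.
    by apply: (@bsum_finite _ _ t0) => k; rewrite /b; [case: ifP|rewrite ltnNge => ->].
  apply: (@bsum_le _ _ (fun t => b t + (2^-1 ^+ j)^-1 * (B t 0 (M t) * f (M t)%:R^-1)) 1)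
    => // [|t]; last first.
     rewrite mul1r /b; case: ltnP => [_|t0t].
      by rewrite lerDl !mulr_ge0// invr_ge0 ltW.
    by rewrite add0r mulrA ler_peMl// ler_pdivlMl// mulr1 small.
  apply: bsumD => //; apply: bsum_le bBf _ (fun=> lexx _).
  by rewrite invr_ge0 ltW.
have [|sel bsel nsel] := @summable_selection _ (fun t => B t 0 (M t)).
  move=> j t0; apply: contrapT => none; apply: big_; exists j, t0 => t t0t.
  by rewrite leNgt; apply/negP => lt; apply: none; exists t.
exfalso; apply: nsel.
have /B_iff : bsum (fun t => B t 0 (if sel t then M t else 0%N)).
  apply: (bsum_le (C := 1) bsel) => // n; rewrite mul1r; case: ifP => // _.
  by rewrite /B big1// => k _; rewrite /dist subrr normr0.
move=> /(_ (fun=> leq0n _)) bs.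
apply: (@bsum_le _ _ _ (g 1)^-1 (bs _)) => [t||t]; first by case: ifP.
  by rewrite invr_ge0 ltW.
rewrite mul0r sub0r normrN; case: (sel t); last by rewrite mul0r normr0 g0 mulr0.
  by rewrite divff ?gt_eqF ?ltr0n// normr1 mulVf// gt_eqF.
Qed.

End NonReduction.

(** * The functions f_W *)

Section Staircase.
Variable R : realType.
Implicit Types (W U V : set nat) (s t : R).

Definition clamp (t : R) : R := Num.max 0 (Num.min t 1).

Lemma clamp_le0 t : t <= 0 -> clamp t = 0.
Proof. by rewrite /clamp => t0; rewrite min_l ?max_l//; lra. Qed.

Lemma clamp_ge1 t : 1 <= t -> clamp t = 1.
Proof. by rewrite /clamp => t0; rewrite min_r// max_r//; lra. Qed.

Lemma clamp_id t : 0 <= t <= 1 -> clamp t = t.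
Proof. by rewrite /clamp => /andP[t0 t1]; rewrite min_l// max_r. Qed.

Lemma clamp_ge0 t : 0 <= clamp t.
Proof. by rewrite /clamp le_max lexx. Qed.

Lemma clamp_le1 t : clamp t <= 1.
Proof. by rewrite /clamp ge_max ler01 ge_min lexx orbT. Qed.

Lemma clamp_le s t : s <= t -> clamp s <= clamp t.
Proof. by move=> st; rewrite /clamp ge_max !le_max lexx/= ge_min le_min !ge_min st lexx !orbT. Qed.

(* The measure of the part of [[0, t]] covered by the intervals [[n, n + 1]], [n \in W]. *)
Definition staircase W t : R :=
  \sum_(0 <= n < (Num.truncn t).+1) (n \in W)%:R * clamp (t - n%:R).

(** Terms with [n >= t] vanish, so the range can be enlarged; several staircases can then be
    compared over a common range. *)
Lemma staircaseE W t N : t <= N%:R ->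
  staircase W t = \sum_(0 <= n < N) (n \in W)%:R * clamp (t - n%:R).
Proof.
have wide m n : t <= m%:R -> (m <= n)%N ->
    \sum_(0 <= k < m) (k \in W)%:R * clamp (t - k%:R) =
    \sum_(0 <= k < n) (k \in W)%:R * clamp (t - k%:R).
  move=> tm mn; rewrite (big_cat_nat (leq0n m) mn)/= [X in _ = _ + X](_ : _ = 0) ?addr0//.
  rewrite big_nat_cond big1// => k /andP[/andP[mk _] _].
  by rewrite clamp_le0 ?mulr0// subr_le0 (le_trans tm)// ler_nat.
move=> tN; have tt := ltW (truncnS_gt t); rewrite /staircase.
by have [h|h] := leqP (Num.truncn t).+1 N; [exact: wide|apply/esym/wide => //; exact: ltnW].
Qed.

Let common s t : exists N, s <= N%:R /\ t <= N%:R.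
Proof.
exists (maxn (Num.truncn s).+1 (Num.truncn t).+1).
by split; [apply: le_trans (ltW (truncnS_gt s)) _|apply: le_trans (ltW (truncnS_gt t)) _];
  rewrite ler_nat (leq_maxl, leq_maxr).
Qed.

Lemma staircase_ge0 W t : 0 <= staircase W t.
Proof. by apply: sumr_ge0 => n _; rewrite mulr_ge0// clamp_ge0. Qed.

Lemma staircase_le0 W t : t <= 0 -> staircase W t = 0.
Proof. by move=> t0; rewrite (@staircaseE _ _ 0)// big_geq. Qed.

Lemma staircase_le W s t : s <= t -> staircase W s <= staircase W t.
Proof.
move=> st; have [N [sN tN]] := common s t; rewrite !(@staircaseE _ _ N)//.
by apply: ler_sum => n _; rewrite ler_wpM2l// clamp_le// lerB.
Qed.

Lemma staircaseT t : 0 <= t -> staircase setT t = t.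
Proof.
move=> t0; have [N [tN _]] := common t t; rewrite (staircaseE _ tN).
suff -> : \sum_(0 <= n < N) (n \in [set: nat])%:R * clamp (t - n%:R) = Num.min t N%:R.
  by rewrite min_l.
elim: N {tN} => [|N IH]; first by rewrite big_geq// min_r.
rewrite big_nat_recr//= IH in_setT mul1r -natr1.
have [h|h] := leP t N%:R.
  by rewrite clamp_le0 ?addr0 ?min_l//; lra.
have [h'|h'] := leP t (N%:R + 1); first by rewrite clamp_id ?subrKC//; lra.
by rewrite clamp_ge1//; lra.
Qed.

Lemma staircase0 t : staircase set0 t = 0.
Proof. by rewrite /staircase big1// => n _; rewrite in_set0 mul0r. Qed.

(** Each summand grows by at most the corresponding summand for [setT], whose staircase is the
    identity on nonnegative arguments. *)
Lemma staircase_lip W s t : s <= t -> staircase W t - staircase W s <= t - s.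
Proof.
move=> st; have mono0 : forall a b, 0 <= a -> a <= b -> staircase W b - staircase W a <= b - a.
  move=> a b a0 ab; rewrite -{2}(staircaseT a0) -{2}(staircaseT (le_trans a0 ab)).
  have [N [aN bN]] := common a b; rewrite !(@staircaseE _ _ N)// -!sumrB.
  apply: ler_sum => n _; rewrite -!mulrBr in_setT mul1r ler_piMl//.
    by rewrite subr_ge0 clamp_le// lerB.
  by case: (_ \in _).
have [s0|/ltW s0] := leP 0 s; first exact: mono0.
rewrite (staircase_le0 _ s0) subr0; have [t0|/ltW t0] := leP 0 t.
  by have := mono0 0 t (lexx 0) t0; rewrite (staircase_le0 W (lexx 0)); lra.
by rewrite staircase_le0//; lra.
Qed.

Lemma staircaseD U V t :
  staircase V t - staircase U t = staircase (V `\` U) t - staircase (U `\` V) t.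
Proof.
have [N [tN _]] := common t t; rewrite !(staircaseE _ tN) -!sumrB.
apply: eq_bigr => n _; rewrite -!mulrBl; congr (_ * _).
by rewrite !in_setD; case: (n \in V); case: (n \in U); rewrite /= ?subrr.
Qed.

Lemma finite_nat_bounded W : finite_set W -> exists m, forall n, W n -> (n < m)%N.
Proof.
move=> /finite_fsetP[X ->]; exists (\max_(i <- finmap.enum_fset X) i)%N.+1 => n nX.
by rewrite ltnS; exact: (leq_bigmax_seq (F := fun i => i) n nX).
Qed.

Lemma staircase_finite W : finite_set W -> exists C, forall t, staircase W t <= C.
Proof.
move=> /finite_nat_bounded[m mP]; exists m%:R => t.
have [N [tN _]] := common t t.
have tN' : t <= (m + N)%:R by rewrite (le_trans tN)// ler_nat leq_addl.
rewrite (staircaseE _ tN') (big_cat_nat (leq0n m) (leq_addr _ _))/=.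
rewrite [X in _ + X](_ : _ = 0) ?addr0; last first.
  rewrite big_nat_cond big1// => k /andP[/andP[mk _] _].
  case: (boolP (k \in W)) => [/set_mem/mP|]; last by rewrite mul0r.
  by rewrite ltnNge mk.
apply: le_trans (_ : \sum_(0 <= n < m) 1 <= _); last by rewrite sumr_const_nat subn0.
apply: ler_sum => n _; case: (_ \in _); last by rewrite mul0r ler01.
by rewrite mul1r clamp_le1.
Qed.

Lemma staircase_infinite W : infinite_set W ->
  forall C : R, exists T, forall t, T <= t -> C <= staircase W t.
Proof.
move=> iW C.
suff H j : exists N, j%:R <= staircase W N%:R.
  have [N NP] := H (Num.truncn C).+1; exists N%:R => t Nt.
  apply: le_trans (staircase_le _ Nt); apply: le_trans NP.
  exact: ltW (truncnS_gt _).
elim: j => [|j [N IH]]; first by exists 0%N; exact: staircase_ge0.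
have [n nN Wn] : exists2 n, (N <= n)%N & W n.
  apply: contrapT => none; apply: iW; apply: (sub_finite_set _ (finite_II N)) => n Wn /=.
  by rewrite ltnNge; apply/negP => Nn; apply: none; exists n.
exists n.+1; rewrite (staircaseE _ (lexx _)) big_nat_recr//= mem_set// mul1r -natr1.
rewrite clamp_ge1; last by rewrite -natr1; lra.
rewrite lerD2r (le_trans IH)// (@staircaseE _ _ n) ?ler_nat//.
apply: ler_sum => k _; rewrite ler_wpM2l// clamp_le// lerB// ler_nat.
exact: leq_trans (leqnSn n).
Qed.

End Staircase.

(** * Regularity of the weighted powers *)

Section Gauges.
Variables (R : realType) (alpha : R).
Hypothesis alpha1 : 1 <= alpha.
Implicit Types (U V W : set nat) (x y : R).

Let alpha0 : 0 < alpha. Proof. exact: lt_le_trans alpha1. Qed.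

Definition growth : R := ln (17 / 16).

Lemma growth01 : 0 < growth < 1.
Proof.
rewrite /growth ln_gt0/=; last lra.
have -> : 17 / 16 = 1 + 1 / 16 :> R by lra.
by apply: le_lt_trans (le_ln1Dx _) _; lra.
Qed.

Definition loglog x : R := ln (1 - ln x).

Definition weight W x := expR (growth * staircase W (loglog x) - loglog x).

Definition pow_weight W x := x `^ alpha * weight W x.

Let L_ge1 x : x <= 1 -> 1 <= 1 - ln x.
Proof. by move=> /ln_le0; lra. Qed.

Lemma expR_loglog x : x <= 1 -> expR (loglog x) = 1 - ln x.
Proof. by move=> /L_ge1 h; rewrite /loglog lnK// posrE; lra. Qed.

Lemma loglog_ge0 x : x <= 1 -> 0 <= loglog x.
Proof. by move=> /L_ge1; exact: ln_ge0. Qed.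

Lemma loglog_le x y : 0 < x -> x <= y -> y <= 1 -> loglog y <= loglog x.
Proof.
move=> x0 xy y1; have y0 := lt_le_trans x0 xy.
have := L_ge1 y1; have := L_ge1 (le_trans xy y1).
have : ln x <= ln y by rewrite ler_ln.
by move=> *; rewrite /loglog ler_ln ?posrE; lra.
Qed.

Lemma weight_gt0 W x : 0 < weight W x. Proof. exact: expR_gt0. Qed.

(** The staircase is 1-Lipschitz and [growth < 1], so the exponent decreases in [loglog x], which
    itself decreases in [x]. *)
Lemma weight_le W x y : 0 < x -> x <= y -> y <= 1 -> weight W x <= weight W y.
Proof.
move=> x0 xy y1; rewrite /weight ler_expR.
have := loglog_le x0 xy y1 => /[dup] /(staircase_le W) h1 /[dup] h2 /(staircase_lip W) h3.
have /andP[p0 p1] := growth01.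
have : growth * (staircase W (loglog x) - staircase W (loglog y)) <=
       staircase W (loglog x) - staircase W (loglog y).
  by rewrite ler_piMl ?(ltW p1)//; lra.
lra.
Qed.

(** Multiplying by [1 - ln x], which is [expR (loglog x)], leaves only the increasing part of the
    exponent. So the weight decays no faster than [1 / (1 - ln x)] at 0. *)
Lemma weight_le_ratio W x y : 0 < x -> x <= y -> y <= 1 ->
  weight W y * (1 - ln y) <= weight W x * (1 - ln x).
Proof.
move=> x0 xy y1; rewrite -!expR_loglog ?(le_trans xy y1)// /weight -!expRD ler_expR !subrK.
rewrite ler_wpM2l ?staircase_le ?loglog_le//.
by have /andP[/ltW] := growth01.
Qed.

Lemma weight_le1 W x : 0 < x -> x <= 1 -> weight W x <= 1.
Proof.
move=> x0 x1; apply: le_trans (weight_le W x0 x1 (lexx 1)) _.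
by rewrite /weight /loglog ln1 subr0 ln1 staircase_le0// mulr0 subr0 expR0.
Qed.

Lemma pow_weight0 W : pow_weight W 0 = 0.
Proof. by rewrite /pow_weight powR0 ?mul0r// gt_eqF. Qed.

Lemma pow_weight1 W : pow_weight W 1 = 1.
Proof.
rewrite /pow_weight powR1 mul1r.
by rewrite /weight /loglog ln1 subr0 ln1 staircase_le0// mulr0 subr0 expR0.
Qed.

Lemma pow_weight_ge0 W x : 0 <= pow_weight W x.
Proof. by rewrite /pow_weight mulr_ge0 ?powR_ge0// ltW// weight_gt0. Qed.

Lemma pow_weight_gt0 W x : 0 < x -> 0 < pow_weight W x.
Proof. by move=> x0; rewrite /pow_weight mulr_gt0 ?powR_gt0// weight_gt0. Qed.

(** The doubling constant: [2^alpha] for the power and 2 for the weight. *)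
Definition pow_weight_const : R := 2 `^ alpha * 2.

Lemma pow_weight_gauge W : gauge (pow_weight W) pow_weight_const.
Proof.
split; first exact: pow_weight0.
- by move=> x _; exact: pow_weight_ge0.
- move=> x y x0 xy y1; have y0 := lt_le_trans x0 xy.
  rewrite /pow_weight -(mulr_powRB1 (ltW x0) alpha0) -(mulr_powRB1 (ltW y0) alpha0).
  set u := x `^ _; set v := y `^ _.
  have -> : x * u * weight W x * y = (x * y) * (u * weight W x) by ring.
  have -> : y * v * weight W y * x = (x * y) * (v * weight W y) by ring.
  rewrite ler_wpM2l ?mulr_ge0 ?(ltW x0) ?(ltW y0)//.
  apply: ler_pM; rewrite ?powR_ge0 ?(ltW (weight_gt0 _ _)) ?weight_le//.
  by apply: ge0_ler_powR; rewrite ?nnegrE ?(ltW x0) ?(ltW y0)// subr_ge0.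
- rewrite /pow_weight_const; have : 1 <= 2 `^ alpha :> R.
    by have := ler_powR (a := 2 : R) _ (ltW alpha0); rewrite powRr0; apply; lra.
  lra.
- move=> x /andP[+ x1]; rewrite le_eqVlt => /predU1P[<-|x0].
    by rewrite mul0r pow_weight0 mulr0.
  have h0 : 0 < x / 2 by lra.
  have L1 := L_ge1 x1; have w0 := weight_gt0 W (x / 2).
  (* Since [ln 2 <= 1], halving [x] at most doubles [1 - ln x]. *)
  have ww : weight W x <= 2 * weight W (x / 2).
    have := weight_le_ratio W h0 (_ : x / 2 <= x) x1 => /(_ ltac:(lra)) h.
    have lnh : ln (x / 2) = ln x - ln 2 by rewrite ln_div// posrE; lra.
    have ln2 : ln 2 <= 1 :> R by have := le_ln1Dx (x := 1 : R); apply; lra.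
    rewrite -(ler_pM2r (_ : 0 < 1 - ln x)); last by lra.
    apply: le_trans h _; rewrite (mulrC 2) -mulrA ler_wpM2l ?(ltW w0)// lnh; lra.
  have -> : pow_weight_const * pow_weight W (x / 2) =
      (2 * (x / 2)) `^ alpha * (2 * weight W (x / 2)).
    by rewrite /pow_weight_const /pow_weight (powRM _ (ler0n _ 2) (ltW h0)) mulrACA.
  have -> : 2 * (x / 2) = x by lra.
  by rewrite /pow_weight ler_wpM2l ?powR_ge0.
Qed.

(** For [y <= x] the number [1 - ln (x * y)] is at most twice [1 - ln y], so the weight at [x * y]
    is at least half of that at [y]; the weight at [x] is at most 1. *)
Lemma pow_weight_mul W x y : 0 < x <= 1 -> 0 < y <= 1 ->
  pow_weight W x * pow_weight W y <= 2 * pow_weight W (x * y).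
Proof.
wlog yx : x y / y <= x.
  move=> H hx hy; have [yx|/ltW xy] := leP y x; first exact: H.
  by rewrite mulrC (mulrC x); exact: H.
move=> /andP[x0 x1] /andP[y0 y1].
have xy0 : 0 < x * y by rewrite mulr_gt0.
have xyy : x * y <= y by rewrite ler_piMl// ltW.
rewrite /pow_weight powRM ?(ltW x0) ?(ltW y0)// mulrACA [leRHS]mulrCA.
rewrite ler_wpM2l ?mulr_ge0 ?powR_ge0//.
apply: le_trans (_ : weight W y <= _).
  by rewrite ler_piMl ?weight_le1// ltW// weight_gt0.
have h := weight_le_ratio W xy0 xyy y1.
have lnyx : ln y <= ln x by rewrite ler_ln.
have w0 := weight_gt0 W (x * y).
rewrite -(ler_pM2r (_ : 0 < 1 - ln y)); last by have := L_ge1 y1; lra.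
apply: le_trans h _; rewrite (mulrC 2) -mulrA ler_wpM2l ?(ltW w0)// lnM ?posrE//.
have := ln_le0 x1; lra.
Qed.

Lemma pow_weight_ratio U V x : pow_weight V x =
  pow_weight U x *
  expR (growth * (staircase (V `\` U) (loglog x) - staircase (U `\` V) (loglog x))).
Proof.
rewrite /pow_weight -mulrA /weight -expRD -staircaseD; congr (_ * expR _); lra.
Qed.

(** The absolute value extends the function to both sides of 0. At 0 it is squeezed by the linear
    bound; elsewhere it is a composition of continuous functions. *)
Lemma pow_weight_abs_continuous W x : `|x| <= 1 -> {for x, continuous (fun y => pow_weight W `|y|)}.
Proof.
move=> x1; have [->|xn0] := eqVneq x 0.
  apply/cvgrPdist_le => e e0; near=> y; rewrite normr0 pow_weight0 sub0r normrN.
  have ny : `|y| <= Num.min e 1.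
    by near: y; apply: cvgr0_norm_le; [exact: cvg_id|rewrite lt_min e0 ltr01].
  rewrite ger0_norm ?pow_weight_ge0//.
  have y1 : `|y| <= 1 by move: ny; rewrite le_min => /andP[].
  apply: le_trans (gauge_le_lin (pow_weight_gauge W) (normr_ge0 y) y1) _.
  by rewrite pow_weight1 mul1r; move: ny; rewrite le_min => /andP[].
have nx0 : 0 < `|x| by rewrite normr_gt0.
have cn : {for x, continuous (fun y : R => ln `|y|)}.
  apply: continuous_comp; first exact: norm_continuous.
  exact: continuous_ln.
have cl : {for x, continuous (fun y => loglog `|y|)}.
  rewrite /loglog; apply: continuous_comp.
    by apply: continuousB => //; exact: cst_continuous.
  by apply: continuous_ln; have := L_ge1 x1; rewrite /=; lra.
have cS : continuous (staircase W : R -> R).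
  move=> t; apply/cvgrPdist_le => e e0; near=> s.
  apply: le_trans (_ : `|t - s| <= _); last first.
    by near: s; apply: cvgr_dist_le => //; exact: cvg_id.
  have [st|/ltW ts] := leP s t.
    by rewrite !ger0_norm ?subr_ge0 ?staircase_le//; exact: staircase_lip.
  by rewrite distrC (distrC t) !ger0_norm ?subr_ge0 ?staircase_le//; exact: staircase_lip.
pose g y := expR (alpha * ln `|y| + (growth * staircase W (loglog `|y|) - loglog `|y|)).
have cg : {for x, continuous g}.
  apply: (@continuous_comp _ _ _ (fun y => _) expR); last exact: continuous_expR.
  apply: continuousD; first by apply: continuousM => //; exact: cst_continuous.
  apply: continuousB => //; apply: continuousM; first exact: cst_continuous.
  by apply: (@continuous_comp _ _ _ (fun y => loglog `|y|) (staircase W)) => //; exact: cS.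
have pg y : y != 0 -> pow_weight W `|y| = g y.
  by move=> y0; rewrite /pow_weight /powR normr_eq0 (negbTE y0) /weight -expRD.
rewrite /prop_for /continuous_at pg//; apply: cvg_trans cg.
apply: near_eq_cvg; near=> y; apply/esym/pg.
by near: y; apply: (cvgr_neq0 x) => //; exact: cvg_id.
Unshelve. all: by end_near. Qed.

End Gauges.

(** * Reducibility *)

Section DoubleSums.
Variable R : realType.

(** By Tonelli the enumerated double series is the series of the row sums, which are comparable with
    [a n]. *)
Lemma bsum_double (e : nat -> nat * nat) (F : nat -> nat -> R) (a : nat -> R) (c C : R) :
  set_bij [set: nat] [set: nat * nat] e -> (forall n j, 0 <= F n j) -> (forall n, 0 <= a n) ->
  0 < c -> 0 <= C ->
  (forall n J, \sum_(0 <= j < J) F n j <= C * a n) ->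
  (forall n, exists J, c * a n <= \sum_(0 <= j < J) F n j) ->
  bsum a <-> bsum (fun m => F (e m).1 (e m).2).
Proof.
move=> be F0 a0 c0 C0 FC cF.
have F0E n j : (0 <= (F n j)%:E)%E by rewrite lee_fin.
have S0 n : (0 <= \sum_(0 <= j <oo) (F n j)%:E)%E by apply: nneseries_ge0.
have Ssum : (\sum_(0 <= m <oo) (F (e m).1 (e m).2)%:E =
             \sum_(0 <= n <oo) \sum_(0 <= j <oo) (F n j)%:E)%E.
  rewrite nneseries_esumT// (nneseries_esumT (a := fun n => _))//.
  rewrite -(reindex_esum [set: nat] [set: nat * nat] e (fun k => (F k.1 k.2)%:E))//.
  under [RHS]eq_esum => n _ do rewrite nneseries_esumT//.
  rewrite esum_esum//; congr (esum _ _).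
  by apply/seteqP; split.
rewrite (bsumP (fun m => F0 (e m).1 (e m).2)) Ssum; split=> [ba|lt].
  have bCa : bsum (fun n => C * a n) by apply: bsum_le ba C0 (fun=> lexx _).
  apply: le_lt_trans ((bsumP (fun n => mulr_ge0 C0 (a0 n))).1 bCa).
  apply: lee_nneseries => // n _.
  apply: lime_le; first by apply: is_cvg_nneseries.
  by apply: nearW => J; rewrite sumEFin lee_fin.
have : bsum (fun n => c * a n).
  apply/bsumP => [n|]; first by rewrite mulr_ge0 ?(ltW c0).
  apply: le_lt_trans lt; apply: lee_nneseries => n _.
    by move=> _; rewrite lee_fin mulr_ge0 ?(ltW c0).
  have [J cJ] := cF n; apply: (@le_trans _ _ (\sum_(0 <= j < J) (F n j)%:E)%E).
    by rewrite sumEFin lee_fin.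
  exact: nneseries_lim_ge.
move=> bca; apply: (bsum_le (C := c^-1) bca) => [|n]; first by rewrite invr_ge0 (ltW c0).
by rewrite mulKf ?gt_eqF.
Qed.

End DoubleSums.

(** * The triangle wave *)

Section TriangleWave.
Variable R : realType.
Implicit Types s t : R.

(* The distance to the nearest even integer. *)
Definition tri t : R := `|t - 2 * (Num.floor ((t + 1) / 2))%:~R|.

Let floorE t : (Num.floor t)%:~R <= t < (Num.floor t)%:~R + 1.
Proof. by rewrite floor_le/= -intrD1 floorD1_gt. Qed.

Lemma tri_le1 t : 0 <= tri t <= 1.
Proof. by rewrite normr_ge0 ler_norml; have := floorE ((t + 1) / 2); lra. Qed.

Lemma tri_le t (q : int) : tri t <= `|t - 2 * q%:~R|.
Proof.
have h := floorE ((t + 1) / 2); rewrite /tri.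
set f := Num.floor _ in h *; have [qf|qf|->//] := ltgtP q f.
  have : (q + 1)%:~R <= f%:~R :> R by rewrite ler_int lezD1.
  rewrite intrD => ?; apply: le_trans (_ : 1 <= _); first by rewrite ler_norml; lra.
  by apply: le_trans (ler_norm _); lra.
have : (f + 1)%:~R <= q%:~R :> R by rewrite ler_int lezD1.
rewrite intrD => ?; apply: le_trans (_ : 1 <= _); first by rewrite ler_norml; lra.
by rewrite distrC; apply: le_trans (ler_norm _); lra.
Qed.

Lemma triE t (q : int) : `|t - 2 * q%:~R| <= 1 -> tri t = `|t - 2 * q%:~R|.
Proof.
move=> h; apply/eqP; rewrite eq_le tri_le/= /tri.
set f := Num.floor _; have [qf|qf|->//] := ltgtP q f.
  have : (q + 1)%:~R <= f%:~R :> R by rewrite ler_int lezD1.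
  rewrite intrD (distrC t (2 * f%:~R)) => ?; move: h; rewrite ler_norml => ?.
  by apply: le_trans (_ : 1 <= _); [rewrite ler_norml; lra|apply: le_trans (ler_norm _); lra].
have : (f + 1)%:~R <= q%:~R :> R by rewrite ler_int lezD1.
rewrite intrD => ?; move: h; rewrite ler_norml => ?.
by apply: le_trans (_ : 1 <= _); [rewrite ler_norml; lra|apply: le_trans (ler_norm _); lra].
Qed.

Lemma tri_lip s t : `|tri s - tri t| <= `|s - t|.
Proof.
have H u v : tri u - tri v <= `|u - v|.
  rewrite lerBlDr; set q := Num.floor ((v + 1) / 2).
  by apply: le_trans (tri_le u q) _; apply: ler_distD.
by rewrite ler_norml H andbT lerNl opprB distrC H.
Qed.

Lemma tri_continuous : continuous tri.
Proof.
move=> t; apply/cvgrPdist_le => e e0; near=> s.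
apply: le_trans (tri_lip t s) _.
by near: s; apply: cvgr_dist_le => //; exact: cvg_id.
Unshelve. all: by end_near. Qed.

Lemma tri_up s t (q : int) : 2 * q%:~R <= s -> s <= t -> t <= 2 * q%:~R + 1 ->
  `|tri s - tri t| = t - s.
Proof.
move=> qs st tq; rewrite !(@triE _ q) ?ler_norml; try lra.
rewrite (@ger0_norm _ (s - 2 * q%:~R)) ?(@ger0_norm _ (t - 2 * q%:~R)); try lra.
by rewrite distrC ger0_norm; lra.
Qed.

Lemma tri_down s t (q : int) : 2 * q%:~R - 1 <= s -> s <= t -> t <= 2 * q%:~R ->
  `|tri s - tri t| = t - s.
Proof.
move=> qs st tq; rewrite !(@triE _ q) ?ler_norml; try lra.
rewrite (@ler0_norm _ (s - 2 * q%:~R)) ?(@ler0_norm _ (t - 2 * q%:~R)); try lra.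
by rewrite ger0_norm; lra.
Qed.

(* The fold points of [tri] and of its translate by [1 / 2] are at distance at
   least [1 / 2], so a short interval avoids those of one of the two. *)
Lemma tri_fold s t : s <= t -> t <= s + 2^-1 ->
  `|tri s - tri t| = t - s \/ `|tri (s + 2^-1) - tri (t + 2^-1)| = t - s.
Proof.
move=> st ts; have := floorE (s / 2); set q := Num.floor _ => hq.
have q1 : (q + 1)%:~R = q%:~R + 1 :> R by rewrite intrD.
have shift (u v : R) : v + 2^-1 - (u + 2^-1) = v - u by lra.
have [h|h] := leP (s - 2 * q%:~R) 2^-1; first by left; apply: (tri_up (q := q)); lra.
have [h1|h1] := leP (s - 2 * q%:~R) 1.
  by right; rewrite -(shift s t); apply: (tri_down (q := q + 1)); rewrite ?q1; lra.
have [h2|h2] := leP (s - 2 * q%:~R) (3 / 2).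
  by left; apply: (tri_down (q := q + 1)); rewrite ?q1; lra.
by right; rewrite -(shift s t); apply: (tri_up (q := q + 1)); rewrite ?q1; lra.
Qed.

Lemma tri_fold_norm s t : `|s - t| <= 2^-1 ->
  `|tri s - tri t| = `|s - t| \/ `|tri (s + 2^-1) - tri (t + 2^-1)| = `|s - t|.
Proof.
rewrite ler_norml => h; have [st|/ltW ts] := leP s t.
  by rewrite (distrC s t) (ger0_norm (_ : 0 <= t - s)) ?subr_ge0//; apply: tri_fold => //; lra.
rewrite (distrC (tri s)) (distrC (tri (s + _))) (ger0_norm (_ : 0 <= s - t)) ?subr_ge0//.
by apply: tri_fold => //; lra.
Qed.

End TriangleWave.

(** * The reduction for nested sets *)

Section Reduction.
Variables (R : realType) (alpha : R).
Hypothesis alpha1 : 1 <= alpha.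
Variables U V : set nat.
Hypothesis UV : U `<=` V.

Let W := V `\` U.
Let fU := pow_weight alpha U.
Let fV := pow_weight alpha V.
Let K : R := pow_weight_const alpha.
Let fUK : gauge fU K. Proof. exact: pow_weight_gauge. Qed.
Let fU0 : fU 0 = 0. Proof. exact: pow_weight0. Qed.
Let fU_ge0 x : 0 <= fU x. Proof. exact: pow_weight_ge0. Qed.
Let K1 : 1 <= K. Proof. by case: fUK. Qed.

(* The gain [fV x / fU x] as a function of [- ln x]. *)
Definition gain (y : R) : R := expR (growth R * staircase W (ln (1 + y))).

Let growth0 : 0 <= growth R. Proof. by have /andP[/ltW] := growth01 R. Qed.

Lemma pow_weight_gain x : fV x = fU x * gain (- ln x).
Proof.
rewrite /fV (pow_weight_ratio _ U V); congr (_ * expR (_ * _)).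
have -> : U `\` V = set0 by apply/seteqP; split => n // [/UV].
by rewrite staircase0 subr0.
Qed.

Lemma gain_le y z : 0 <= y -> y <= z -> gain y <= gain z.
Proof.
move=> y0 yz; rewrite /gain ler_expR ler_wpM2l// staircase_le// ler_ln ?posrE; lra.
Qed.

Lemma gain0 : gain 0 = 1.
Proof. by rewrite /gain addr0 ln1 staircase_le0// mulr0 expR0. Qed.

Lemma gain_ge1 y : 0 <= y -> 1 <= gain y.
Proof. by move=> y0; rewrite -gain0 gain_le. Qed.

(** With [a = ln (1 + y)] and [b = ln (2 + y)], the exponent of the gain is at most [a] at [y] and
    rises by at most [b - a]; hence the gain rises by at most [expR b - expR a = 1]. *)
Lemma gainS y : 0 <= y -> gain (y + 1) <= gain y + 1.
Proof.
move=> y0; pose a := ln (1 + y); pose b := ln (1 + (y + 1)).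
have a0 : 0 <= a by apply: ln_ge0; lra.
have ab : a <= b by rewrite /a /b ler_ln ?posrE; lra.
have ea : expR a = 1 + y by rewrite /a lnK// posrE; lra.
have eb : expR b = 1 + (y + 1) by rewrite /b lnK// posrE; lra.
have Sa : staircase W a <= a by have := staircase_lip W a0; rewrite (staircase_le0 _ (lexx 0)); lra.
have Sab := staircase_lip W ab; have Sm := staircase_le W ab; have S0 := staircase_ge0 W a.
have /andP[p0 p1] := growth01 R.
rewrite /gain -/a -/b.
have -> : growth R * staircase W b =
    growth R * staircase W a + growth R * (staircase W b - staircase W a) by lra.
set u := growth R * staircase W a; set v := growth R * _.
have ua : u <= a by apply: le_trans Sa; rewrite ler_piMl ?(ltW p1).
have vb : v <= b - a by apply: le_trans Sab; rewrite ler_piMl ?(ltW p1)//; lra.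
have v0 : 0 <= v by rewrite mulr_ge0 ?(ltW p0)//; lra.
suff : expR (u + v) - expR u <= 1 by lra.
apply: le_trans (_ : expR a * (expR (b - a) - 1) <= _).
  have -> : expR (u + v) - expR u = expR u * (expR v - 1) by rewrite expRD mulrBr mulr1.
  rewrite ler_pM ?expR_ge0 ?ler_expR ?lerB ?ler_expR//.
  by rewrite subr_ge0 -expR0 ler_expR.
by rewrite mulrBr -expRD mulr1 subrKC ea eb; lra.
Qed.

Definition level (i : nat) : nat := Num.truncn (gain i%:R).

Lemma level_ge1 i : (1 <= level i)%N.
Proof. by rewrite /level truncn_gt0 gain_ge1. Qed.

Lemma level_le i : (level i)%:R <= gain i%:R.
Proof. by rewrite /level truncn_le expR_ge0. Qed.

Lemma gain_level i : gain i%:R <= 2 * (level i)%:R.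
Proof.
apply: le_trans (ltW (truncnS_gt _)) _; rewrite -/(level i) -natr1.
have : 1 <= (level i)%:R :> R by rewrite ler1n level_ge1.
lra.
Qed.

Definition jump (i : nat) : bool := if i is j.+1 then (level j < level i)%N else true.

(** By [gainS] the level rises by at most one per step. It starts at 1, which accounts for the jump
    at 0. *)
Lemma sum_jump n : (\sum_(0 <= i < n.+1) jump i = level n)%N.
Proof.
elim: n => [|n IH]; first by rewrite big_nat1 /level gain0 truncn1.
rewrite big_nat_recr//= IH.
have h1 : (level n <= level n.+1)%N.
  by rewrite /level truncn_ge_nat ?expR_ge0// (le_trans (level_le n))// gain_le// ler_nat.
have h2 : (level n.+1 <= (level n).+1)%N.
  rewrite -ltnS /level truncn_lt_nat ?expR_ge0// -natr1.
  apply: le_lt_trans (gainS _) _ => //; rewrite -natr1 ltrD2r; exact: truncnS_gt.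
by case: ltnP => h /=; lia.
Qed.

(* The even and odd coordinates are the two translates of the wave at scale
   [expR (- i)]; the scales used are the jumps of the integer part of the gain. *)
Definition zigzag (j : nat) (x : R) : R := (jump j./2)%:R *
  (expR (- j./2%:R) * tri (expR j./2%:R * x / 2 + (odd j)%:R / 2)).

Lemma expRN_nat_le1 (i : nat) : expR (- i%:R) <= 1 :> R.
Proof. by rewrite -[leRHS]expR0 ler_expR oppr_le0. Qed.

Lemma zigzag01 j x : 0 <= zigzag j x <= 1.
Proof.
have /andP[t0 t1] := tri_le1 (expR j./2%:R * x / 2 + (odd j)%:R / 2).
rewrite /zigzag; case: jump; last by rewrite mul0r lexx ler01.
rewrite mul1r mulr_ge0 ?expR_ge0//= mulr_ile1 ?expR_ge0 ?expRN_nat_le1//.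
Qed.

Lemma zigzag_continuous j : continuous (zigzag j).
Proof.
suff H x : {for x, continuous (zigzag j)} by move=> x; exact: H.
rewrite /zigzag; apply: continuousM; first exact: cst_continuous.
apply: continuousM; first exact: cst_continuous.
apply: continuous_comp; last exact: tri_continuous.
apply: continuousD; last exact: cst_continuous.
apply: continuousM; last exact: cst_continuous.
by apply: continuousM; [exact: cst_continuous|exact: cvg_id].
Qed.

Let F x y j := fU `|zigzag j y - zigzag j x|.
Let pair x y i := F x y i.*2 + F x y i.*2.+1.

Let F_le x y j c : (jump j./2 -> `|zigzag j y - zigzag j x| <= c <= 1) ->
  F x y j <= (jump j./2)%:R * fU c.
Proof.
rewrite /F /zigzag; case: (jump j./2) => H; last by rewrite !mul0r subr0 normr0 fU0.
by have /andP[h1 h2] := H isT; rewrite (mul1r (fU c)); apply: (gauge_le fUK).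
Qed.

Let diff_zigzag x y j : jump j./2 -> `|zigzag j y - zigzag j x| =
  expR (- j./2%:R) * `|tri (expR j./2%:R * y / 2 + (odd j)%:R / 2) -
    tri (expR j./2%:R * x / 2 + (odd j)%:R / 2)|.
Proof.
by move=> ji; rewrite /zigzag ji !mul1r -mulrBr normrM ger0_norm ?expR_ge0.
Qed.

Let sum_pairs x y n : \sum_(0 <= j < n.*2) F x y j = \sum_(0 <= i < n) pair x y i.
Proof.
elim: n => [|n IH]; first by rewrite !big_geq.
by rewrite doubleS !big_nat_recr//= IH addrA.
Qed.

Let pair_le x y i : `|y - x| <= 1 -> pair x y i <= 2 * ((jump i)%:R * fU `|y - x|).
Proof.
move=> d1; suff H j : F x y j <= (jump j./2)%:R * fU `|y - x|.
  have := H i.*2; have := H i.*2.+1.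
  by rewrite /= uphalf_double doubleK /pair; lra.
apply: F_le => ji; rewrite d1 andbT diff_zigzag//.
apply: le_trans (ler_wpM2l (expR_ge0 _) (tri_lip _ _)) _.
rewrite [X in `|X|](_ : _ = expR j./2%:R * ((y - x) / 2)); last by lra.
rewrite normrM (ger0_norm (expR_ge0 _)) mulrA -expRD addNr expR0 mul1r normrM.
by rewrite (ger0_norm (_ : 0 <= 2^-1))//; have := normr_ge0 (y - x); lra.
Qed.

(** The waves at scale [i] have height [expR (- i)]. *)
Let pair_le_tail x y i : pair x y i <= 2 * fU (expR (- i%:R)).
Proof.
suff H j : F x y j <= fU (expR (- j./2%:R)).
  have := H i.*2; have := H i.*2.+1.
  by rewrite /= uphalf_double doubleK /pair; lra.
apply: le_trans (F_le (c := expR (- j./2%:R)) _) _; last first.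
  by case: jump; rewrite ?mul1r// mul0r.
move=> ji; rewrite expRN_nat_le1 andbT diff_zigzag// ler_piMr ?expR_ge0//.
set u := tri _; set v := tri _.
have : 0 <= u <= 1 by exact: tri_le1.
have : 0 <= v <= 1 by exact: tri_le1.
by move=> *; rewrite ler_norml; lra.
Qed.

(** The wave arguments differ by at most 1/2, so by [tri_fold_norm] one of the two translates does
    not fold between them. The waves have slope 1/2, whence the displacement [|y - x| / 2]. *)
Let pair_ge x y i : jump i -> `|y - x| <= 1 -> expR i%:R * `|y - x| <= 1 ->
  fU (`|y - x| / 2) <= pair x y i.
Proof.
move=> ji d1 ei.
have e0 : odd i.*2 = false by rewrite odd_double.
have h0 := @diff_zigzag x y i.*2; have h1 := @diff_zigzag x y i.*2.+1.
rewrite /= uphalf_double doubleK odd_double in h0 h1.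
have {}h0 := h0 ji; have {}h1 := h1 ji.
rewrite /= mul0r !addr0 in h0; rewrite /= mul1r in h1.
have d : `|expR i%:R * y / 2 - expR i%:R * x / 2| = expR i%:R * (`|y - x| / 2).
  have -> : expR i%:R * y / 2 - expR i%:R * x / 2 = expR i%:R * ((y - x) / 2) by lra.
  by rewrite normrM (ger0_norm (expR_ge0 _)) normrM (ger0_norm (_ : 0 <= 2^-1)).
have [|h|h] := @tri_fold_norm R (expR i%:R * y / 2) (expR i%:R * x / 2); first by rewrite d; lra.
  rewrite h d mulrA -expRD addNr expR0 mul1r in h0.
  by rewrite /pair /F h0 lerDl.
rewrite h d mulrA -expRD addNr expR0 mul1r in h1.
by rewrite /pair /F h1 lerDr.
Qed.

(** Let [d] be the distance and [k] the integer part of [- ln d]. Up to scale [k] there are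
    [level k] jumps, each contributing at most [2 * fU d]; the finer scales add at most [4 * fU d]
    by geometric decay. As the gain is at least 1, the total is at most [6 * fV d]. *)
Lemma zigzag_upper x y J : `|y - x| <= 1 -> \sum_(0 <= j < J) F x y j <= 6 * fV `|y - x|.
Proof.
move=> d1; have F0 j : 0 <= F x y j by exact: fU_ge0.
apply: le_trans (_ : \sum_(0 <= j < J.*2) F x y j <= _).
  by apply: sum_nat_widen => //; rewrite -addnn leq_addl.
rewrite sum_pairs; set d := `|y - x| in d1 *.
have : 0 <= d by exact: normr_ge0.
rewrite le_eqVlt => /predU1P[d0|d0].
  have up0 : 0 <= 6 * fV d by apply: mulr_ge0 => //; exact: pow_weight_ge0.
  rewrite big1// => i _; apply/eqP; rewrite eq_le addr_ge0 ?andbT//.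
  by apply: le_trans (pair_le i _) _; rewrite -/d -?d0 ?fU0 ?mulr0.
have L0 : 0 <= - ln d by have := ln_le0 d1; lra.
pose k := Num.truncn (- ln d).
have /andP[k1 k2] := truncn_itv L0; rewrite -/k -/k.+1 in k1 k2.
have pair0 i : 0 <= pair x y i by rewrite addr_ge0.
apply: le_trans (_ : \sum_(0 <= i < k.+1 + J) pair x y i <= _).
  by apply: sum_nat_widen => //; rewrite leq_addl.
rewrite (big_cat_nat (leq0n k.+1) (leq_addr _ _))/=.
have head : \sum_(0 <= i < k.+1) pair x y i <= 2 * ((level k)%:R * fU d).
  rewrite -sum_jump natr_sum mulr_suml mulr_sumr; apply: ler_sum => i _; exact: pair_le.
have tail : \sum_(k.+1 <= i < k.+1 + J) pair x y i <= 4 * fU d.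
  rewrite -{1}[k.+1]add0n big_addn addKn.
  apply: le_trans (_ : \sum_(0 <= i < J) 2 * fU d * 2^-1 ^+ i <= _).
    apply: ler_sum => i _; apply: le_trans (pair_le_tail _ _ _) _.
    rewrite -mulrA ler_wpM2l//.
    (* This uses [expR 1 >= 2]; monotonicity of [fU x / x] then carries the factor [2^-i] over to
       [fU]. *)
    have ed : expR (- (i + k.+1)%:R) <= d * 2^-1 ^+ i.
      rewrite natrD opprD addrC expRD ler_pM ?expR_ge0//.
        rewrite -[leRHS](@lnK R) ?posrE// ler_expR; lra.
      rewrite expRN -[i%:R]mul1r expRM exprVn lef_pV2 ?posrE ?powR_gt0 ?expR_gt0 ?exprn_gt0//.
      rewrite powR_mulrn ?expR_ge0// lerXn2r ?nnegrE ?expR_ge0//.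
      by have := expR_ge1Dx (1 : R); lra.
    have ed' : d * 2^-1 ^+ i <= d.
      by rewrite ler_piMr ?(ltW d0)// exprn_ile1 ?invr_ge0// invf_le1// ler1n.
    rewrite -(ler_pM2r d0); have [_ _ fmul _ _] := fUK.
    apply: le_trans (fmul _ _ (expR_gt0 _) (le_trans ed ed') d1) _.
    by rewrite -(mulrA (fU d)) ler_wpM2l// mulrC.
  rewrite -mulr_sumr.
  have h := sum_geom_half_le R J.
  by have := ler_wpM2l (mulr_ge0 (ler0n R 2) (fU_ge0 d)) h; lra.
have lv : (level k)%:R <= gain (- ln d) by rewrite (le_trans (level_le k))// gain_le.
have lv1 : 1 <= (level k)%:R :> R by rewrite ler1n level_ge1.
rewrite pow_weight_gain; have := ler_wpM2l (fU_ge0 d) lv; have := ler_wpM2l (fU_ge0 d) lv1.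
by move: head tail; lra.
Qed.

(** The scales up to [k] suffice: each of the [level k] jumps contributes at least [fU (d / 2)],
    which is at least [fU d / K], and [level k] is at least a quarter of the gain. *)
Lemma zigzag_lower x y : `|y - x| <= 1 ->
  exists J, (4 * K)^-1 * fV `|y - x| <= \sum_(0 <= j < J) F x y j.
Proof.
move=> d1; set d := `|y - x| in d1 *.
have F0 j : 0 <= F x y j by exact: fU_ge0.
have : 0 <= d by exact: normr_ge0.
rewrite le_eqVlt => /predU1P[d0|d0].
  by exists 0%N; rewrite big_geq// -d0 /fV pow_weight0// mulr0.
have L0 : 0 <= - ln d by have := ln_le0 d1; lra.
pose k := Num.truncn (- ln d).
have /andP[k1 k2] := truncn_itv L0; rewrite -/k -/k.+1 in k1 k2.
exists k.+1.*2; rewrite sum_pairs.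
apply: le_trans (_ : (level k)%:R * fU (d / 2) <= _); last first.
  rewrite -sum_jump natr_sum mulr_suml big_nat_cond [leRHS]big_nat_cond.
  apply: ler_sum => i /andP[/andP[_ ik] _].
  case: (boolP (jump i)) => [ji|_]; last by rewrite mul0r addr_ge0.
  have ikR : i%:R <= k%:R :> R by rewrite ler_nat.
  have : expR i%:R * expR (ln d) <= 1 by rewrite -expRD -[leRHS]expR0 ler_expR; lra.
  by rewrite lnK ?posrE// mul1r => ed; exact: pair_ge.
have gk : gain (- ln d) <= 4 * (level k)%:R.
  have h1 : gain (- ln d) <= gain (k%:R + 1) by apply: gain_le => //; rewrite natr1 ltW.
  have h2 := gainS (ler0n R k); have h3 := gain_level k.
  have : 1 <= (level k)%:R :> R by rewrite ler1n level_ge1.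
  lra.
have [_ _ _ _ fhalf] := fUK.
have fd : fU d <= K * fU (d / 2) by apply: fhalf; rewrite (ltW d0).
rewrite ler_pdivrMl; last by rewrite mulr_gt0//; apply: lt_le_trans K1.
rewrite pow_weight_gain.
apply: le_trans (ler_pM (fU_ge0 _) (expR_ge0 _) fd gk) _.
lra.
Qed.

Lemma pow_weight_borel_le_sub :
  borel_le (Erel (fun x : unit_itv R => fV (val x))) (Erel (fun x : unit_itv R => fU (val x))).
Proof.
have /card_esym/card_set_bijP[e be] := card_nat2.
have z01 j x : zigzag j x \in (`[0, 1]%classic : set R).
  by apply/mem_set; rewrite /= in_itv /= zigzag01.
pose theta (x : hilbert_cube R) : hilbert_cube R :=
  fun m => exist _ (zigzag (e m).2 (val (x (e m).1))) (z01 _ _).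
exists theta.
  apply: continuous_borel_fun => x; apply: cvg_cube => [|m].
    by apply: fmap_filter; exact: nbhs_filter.
  have vc : continuous (val : unit_itv R -> R) by exact: initial_continuous.
  have : continuous (fun y : hilbert_cube R => theta y m).
    apply: continuous_comp_initial => y.
    apply: (@continuous_comp _ _ _ (fun y : hilbert_cube R => val (y (e m).1)) (zigzag (e m).2)).
      by apply: continuous_comp; [exact: cube_coord_continuous|exact: vc].
    exact: zigzag_continuous.
  exact.
move=> x x'; rewrite !ErelE; [|by move=> z; exact: fU_ge0|by move=> z; exact: pow_weight_ge0].
rewrite /=; have d1 n : `|val (x' n) - val (x n)| <= 1.
  by case: (unit_dist (x n) (x' n)) => ? /=; have := unit_dist_subproof (x n) (x' n);
   move=> /set_mem /=; rewrite in_itv /= => /andP[].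
apply: (bsum_double (F := fun n j => F (val (x n)) (val (x' n)) j)
  (c := (4 * K)^-1) (C := 6)) => //.
- by move=> n j; exact: fU_ge0.
- by move=> n; exact: pow_weight_ge0.
- by rewrite invr_gt0 mulr_gt0//; apply: lt_le_trans K1.
- by move=> n J; exact: zigzag_upper (d1 n).
- by move=> n; exact: zigzag_lower (d1 n).
Qed.

End Reduction.

(** * The order on the relations *)

Section Comparison.
Variables (R : realType) (alpha : R).
Hypothesis alpha1 : 1 <= alpha.
Implicit Types U V W : set nat.

Definition Epow W := Erel (fun x : unit_itv R => pow_weight alpha W (val x)).

Lemma EpowE W (x y : hilbert_cube R) :
  Epow W x y <-> bsum (fun n => pow_weight alpha W `|val (y n) - val (x n)|).
Proof. by rewrite /Epow ErelE// => z; exact: pow_weight_ge0. Qed.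

Lemma unit_itv01 (z : unit_itv R) : 0 <= val z <= 1.
Proof. by case: z => v /= /set_mem; rewrite /= in_itv. Qed.

Lemma Epow_equivalence W : RelationClasses.Equivalence (Epow W).
Proof.
have wK := pow_weight_gauge alpha1 W; have [w0 _ _ K1 _] := wK.
split=> [x|x y|x y z].
- apply/EpowE; exists 0 => n; rewrite big1// => k _.
  by rewrite subrr normr0 w0.
- move=> /EpowE xy; apply/EpowE; congr bsum : xy.
  by apply/funext => n; rewrite distrC.
- move=> /EpowE xy /EpowE yz; apply/EpowE.
  apply: (bsum_le (C := pow_weight_const alpha) (bsumD yz xy)); first by lra.
  by move=> n; apply: (gauge_triangle wK); exact: unit_itv01.
Qed.

(** Adding a finite set multiplies the weight by a factor between 1 and [expR (growth R * C)]. This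
    reduces inclusion modulo finite sets to inclusion. *)
Lemma Epow_union U V : finite_set (U `\` V) -> forall x y, Epow V x y <-> Epow (U `|` V) x y.
Proof.
move=> fUV x y; rewrite !EpowE.
have [C CP] := staircase_finite R fUV.
have /andP[p0 _] := growth01 R.
have e1 : V `\` (U `|` V) = set0 by apply/seteqP; split => n // [Vn []]; right.
have e2 : (U `|` V) `\` V = U `\` V.
  by apply/seteqP; split => n [] => [[|]//|Un nV]; split => //; left.
have w0 z : 0 <= pow_weight alpha V z by exact: pow_weight_ge0.
split=> [bV|bUV].
  apply: (bsum_le (C := expR (growth R * C)) bV (expR_ge0 _)) => n.
  rewrite (pow_weight_ratio _ V (U `|` V)) e1 e2 staircase0 subr0 mulrC ler_wpM2r//.
  by rewrite ler_expR ler_wpM2l ?(ltW p0)// CP.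
apply: (bsum_le (C := 1) bUV) => // n.
rewrite (pow_weight_ratio _ V (U `|` V)) e1 e2 staircase0 subr0 mul1r ler_peMr//.
by rewrite -[leLHS]expR0 ler_expR mulr_ge0 ?(ltW p0) ?staircase_ge0.
Qed.

Lemma Epow_borel_le U V : finite_set (U `\` V) -> borel_le (Epow V) (Epow U).
Proof.
move=> fUV; have [theta bt tE] := pow_weight_borel_le_sub alpha1 (@subsetUl _ U V).
exists theta; first exact: bt.
move=> x x'; apply: iff_trans (Epow_union fUV x x') _; exact: tE x x'.
Qed.

(** List the [j]-th value [M] exactly [N] times: this batch adds at most [2^-j] to the first series
    and at least 1 to the second. *)
Lemma repeat_sequence (a b : nat -> R) : (forall n, 0 <= a n) -> (forall n, 0 <= b n) ->
  (forall j, exists M N, [/\ (0 < M)%N, (0 < N)%N, N%:R * a M <= 2^-1 ^+ j & 1 <= N%:R * b M]) ->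
  exists M : nat -> nat, [/\ forall t, (0 < M t)%N, bsum (a \o M) & ~ bsum (b \o M)].
Proof.
move=> a0 b0 ex.
have /choice[q qP] : forall j, exists q : nat * nat,
    [/\ (0 < q.1)%N, (0 < q.2)%N, q.2%:R * a q.1 <= 2^-1 ^+ j & 1 <= q.2%:R * b q.1].
  by move=> j; have [M [N H]] := ex j; exists (M, N).
(* The state is the current batch together with the number of its copies already listed. *)
pose next (p : nat * nat) := if (p.2.+1 < (q p.1).2)%N then (p.1, p.2.+1) else (p.1.+1, 0%N).
pose st t := iter t next (0%N, 0%N).
have stS t : st t.+1 = next (st t) by [].
have stlt t : ((st t).2 < (q (st t).1).2)%N.
  elim: t => [|t IH]; first by have [] := qP 0%N.
  by rewrite stS /next; case: ifP => //= _; have [] := qP (st t).1.+1.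
exists (fun t => (q (st t).1).1); split=> [t||[B bB]]; first by have [] := qP (st t).1.
- exists 2 => t.
  (* The batches completed before the current one contribute at most the geometric sum
     [2 - 2 * 2^-j]. *)
  have inv : \sum_(0 <= s < t) a (q (st s).1).1 <=
      2 - 2 * 2^-1 ^+ (st t).1 + (st t).2%:R * a (q (st t).1).1.
    elim: t => [|t IH]; first by rewrite big_geq// /st /= expr0 mul0r; lra.
    rewrite big_nat_recr// stS /next; case: ifP => /= [_|/negbT].
      by rewrite -natr1 mulrDl mul1r; lra.
    rewrite -leqNgt => h; have e : (q (st t).1).2 = (st t).2.+1.
      by apply/eqP; rewrite eqn_leq h stlt.
    have [_ _ h' _] := qP (st t).1; rewrite e -natr1 mulrDl mul1r in h'.
    rewrite mul0r addr0 exprS mulrA divff// mul1r; lra.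
  apply: le_trans inv _; have [_ _ h _] := qP (st t).1.
  have : (st t).2%:R * a (q (st t).1).1 <= (q (st t).1).2%:R * a (q (st t).1).1.
    by rewrite ler_wpM2r// ler_nat ltnW.
  have : 0 <= 2^-1 ^+ (st t).1 :> R by rewrite exprn_ge0// invr_ge0.
  lra.
- have inv t : (st t).1%:R + (st t).2%:R * b (q (st t).1).1 <= \sum_(0 <= s < t) b (q (st s).1).1.
    elim: t => [|t IH]; first by rewrite big_geq// /st /= mul0r addr0.
    rewrite big_nat_recr// stS /next; case: ifP => /= [_|/negbT].
      by rewrite -natr1 mulrDl mul1r; lra.
    rewrite -leqNgt => h; have e : (q (st t).1).2 = (st t).2.+1.
      by apply/eqP; rewrite eqn_leq h stlt.
    have [_ _ _ h'] := qP (st t).1; rewrite e -natr1 mulrDl mul1r in h'.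
    rewrite mul0r addr0 -natr1; lra.
  have reach j : exists t, st t = (j, 0%N).
    elim: j => [|j [t IH]]; first by exists 0%N.
    have step r : (r < (q j).2)%N -> st (t + r)%N = (j, r).
      elim: r => [|r IHr] rj; first by rewrite addn0.
      by rewrite addnS stS IHr ?(ltnW rj)// /next /= rj.
    have [_ N0 _ _] := qP j.
    exists (t + (q j).2)%N; rewrite -(prednK N0) addnS stS step ?prednK//.
    by rewrite /next /= prednK// ltnn.
  have [t tP] := reach (Num.truncn B).+1.
  have := inv t; rewrite tP /= mul0r addr0 => /le_trans/(_ (bB t)).
  by rewrite leNgt truncnS_gt.
Qed.

Lemma Epow_not_borel_le U V : finite_set (U `\` V) -> infinite_set (V `\` U) ->
  ~ borel_le (Epow U) (Epow V).
Proof.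
move=> fUV iVU red.
have /andP[p0 _] := growth01 R.
have [C CP] := staircase_finite R fUV.
pose a M := pow_weight alpha U (M%:R^-1); pose b M := pow_weight alpha V (M%:R^-1).
have [|||M [M0 aM]] := @repeat_sequence a b; last first.
- apply; apply: (reduction_bsum (pow_weight_gauge alpha1 V) (pow_weight_mul alpha V)
    _ _ _ _ red M0 aM) => //.
  + exact: pow_weight0.
  + by move=> x _; exact: pow_weight_ge0.
  + by rewrite pow_weight1.
(* Beyond [T] the factor from [U] to [V] is at least [2^(j+1)], even after the loss of at most [C]
   in the exponent caused by the finite difference. *)
- move=> j; have [T TP] := staircase_infinite iVU (C + ln (2 ^+ j.+1) / growth R).
  (* The double exponential brings [loglog (1 / M)] past [T]; the summand [2 ^+ j] makes [a M] at
     most [2^-j]. *)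
  pose M := (Num.truncn (expR (expR T) + 2 ^+ j)).+1.
  have Mgt : expR (expR T) + 2 ^+ j < M%:R :> R by exact: truncnS_gt.
  have j0 : 0 < 2 ^+ j :> R by rewrite exprn_gt0.
  have eT := expR_gt0 (expR T).
  have Mi0 : 0 < M%:R^-1 :> R by rewrite invr_gt0 ltr0n.
  have Mi1 : M%:R^-1 <= 1 :> R by rewrite invf_le1 ?ltr0n// ler1n.
  have TM : T <= loglog (M%:R^-1 : R).
    rewrite /loglog lnV ?posrE ?ltr0n// opprK -[leLHS]expRK ler_ln ?posrE ?expR_gt0//.
      have : expR T <= ln M%:R by rewrite -[leLHS]expRK ler_ln ?posrE ?ltr0n//; lra.
      lra.
    by have := ln_ge0 (_ : 1 <= M%:R :> R); rewrite ler1n => /(_ isT); lra.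
  have a0 : 0 < a M by exact: pow_weight_gt0.
  have aj : a M <= 2^-1 ^+ j.
    apply: le_trans (gauge_le_lin (pow_weight_gauge alpha1 U) (ltW Mi0) Mi1) _.
    rewrite pow_weight1 mul1r exprVn lef_pV2 ?posrE ?ltr0n//; lra.
  have ab : 2 ^+ j.+1 * a M <= b M.
    rewrite /b (pow_weight_ratio _ U V) mulrC ler_wpM2l ?(ltW a0)//.
    rewrite -[leLHS]lnK ?posrE ?exprn_gt0// ler_expR mulrC -ler_pdivrMr//.
    have := TP _ TM; have := CP (loglog (M%:R^-1 : R)); lra.
  (* The number of copies is the integer part of [x]. As [x >= 1], rounding loses at most a factor
     2, which the exponent [j.+1] makes up for. *)
  pose x := 2^-1 ^+ j / a M.
  have x1 : 1 <= x by rewrite ler_pdivlMr// mul1r.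
  have x0 : 0 <= x by lra.
  exists M, (Num.truncn x); split=> //; first by rewrite truncn_gt0.
    by rewrite -ler_pdivlMr// truncn_le.
  have N1 : 1 <= (Num.truncn x)%:R :> R by rewrite ler1n truncn_gt0.
  have := truncnS_gt x; rewrite -natr1 => xN.
  apply: le_trans (_ : (Num.truncn x)%:R * (2 ^+ j.+1 * a M) <= _); last by rewrite ler_wpM2l.
  have xa : x * a M = 2^-1 ^+ j by rewrite /x divfK// gt_eqF.
  have h : x * a M <= 2 * (Num.truncn x)%:R * a M by rewrite ler_wpM2r ?(ltW a0)//; lra.
  rewrite xa in h.
  have := ler_wpM2l (ltW j0) h; rewrite exprVn divff ?gt_eqF// exprS; lra.
- by move=> n; exact: pow_weight_ge0.
- by move=> n; exact: pow_weight_ge0.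
Qed.

Lemma id_pow_logE (c : R) W : (forall t, 0 <= t -> c * t = t - growth R * staircase W t) ->
  id_pow_log alpha c = (fun x : unit_itv R => pow_weight alpha W (val x)).
Proof.
move=> cW; apply/funext => x; rewrite /id_pow_log; have /andP[x0 x1] := unit_itv01 x.
case: eqP => [->|_]; first by rewrite pow_weight0.
rewrite /pow_weight; congr (_ * _).
have L : 1 <= 1 - ln (val x) by have := ln_le0 x1; lra.
rewrite /powR ifF; last by apply/negbTE; lra.
rewrite -/(loglog (val x)) cW ?loglog_ge0// -expRN opprB; congr expR; lra.
Qed.

Lemma pow_weight_continuous W : continuous (fun x : unit_itv R => pow_weight alpha W (val x)).
Proof.
have vc : continuous (val : unit_itv R -> R) by exact: initial_continuous.
have -> : (fun x : unit_itv R => pow_weight alpha W (val x)) =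
    (fun y => pow_weight alpha W `|y|) \o (val : unit_itv R -> R).
  by apply/funext => z /=; rewrite ger0_norm//; have /andP[] := unit_itv01 z.
suff H x : {for x, continuous ((fun y => pow_weight alpha W `|y|) \o (val : unit_itv R -> R))}.
  by move=> x; exact: H.
apply: continuous_comp; first exact: vc.
apply: pow_weight_abs_continuous => //; have /andP[x0 x1] := unit_itv01 x.
by rewrite ger0_norm.
Qed.

End Comparison.

Theorem corollary31 (R : realType) (alpha : R) (halpha : 1 <= alpha) :
  exists F : Pomega_fin -> continuousType (unit_itv R) R,
    (forall (U : Pomega_fin) (x : unit_itv R), 0 <= F U x) /\
    forall U V : Pomega_fin,
      [/\ RelationClasses.Equivalence (Erel (F U)),
          borel_le (Erel (id_pow_log alpha (1 - ln (17 / 16)))) (Erel (F U)),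
          borel_le (Erel (F U)) (Erel (id_pow_log alpha 1)) &
          Pomega_fin_lt U V -> borel_lt (Erel (F V)) (Erel (F U))].
Proof.
pose F (U : Pomega_fin) : continuousType (unit_itv R) R :=
  HB.pack (fun x : unit_itv R => pow_weight alpha (repr U) (val x))
    (isContinuous.Build _ _ _ (pow_weight_continuous halpha (W := repr U))).
exists F; split=> [U x|U V]; first exact: pow_weight_ge0.
have low : id_pow_log alpha (1 - ln (17 / 16)) =
    (fun x : unit_itv R => pow_weight alpha setT (val x)).
  by apply: id_pow_logE => // t t0; rewrite staircaseT// mulrBl mul1r.
have hi : id_pow_log alpha 1 = (fun x : unit_itv R => pow_weight alpha set0 (val x)).
  by apply: id_pow_logE => // t t0; rewrite staircase0 mulr0 subr0 mul1r.
split.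
- exact: Epow_equivalence.
- by rewrite low; apply: Epow_borel_le => //; rewrite setDT.
- by rewrite hi; apply: Epow_borel_le => //; rewrite set0D.
- move=> [fUV iVU]; split; first exact: Epow_borel_le.
  exact: Epow_not_borel_le.
Qed.
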